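(* Let $D=(X,E,A^0)$ and $D'=(X,E,A^\delta)$ be two weighted digraphs with the same vertex set $X$ and edge set $E$, and with $d_E(A^0,A^\delta)=\delta$. Then for every integer $p\ge 0$, $$d_B\big(V^D_p,V^{D'}_p\big)\le d_E(A^0,A^\delta).$$
   Context: Fix a field $k$. Weighted digraphs. A weighted digraph is a triple $(X,E,A)$ with $X$ a finite set, $E\subseteq X\times X\setminus\{(x,x):x\in X\}$ and $A:E\to\mathbb{R}$. For two weight functions on $E$, $d_E(A,A')=\max_{(x,y)\in E}|A(x,y)-A'(x,y)|$. Homology of graded subgroups. A graded subgroup $D_*$ of a chain complex $(C_*,\partial)$ of $k$-vector spaces is a family of subspaces $D_p\subseteq C_p$. Its supremum complex is the subcomplex $S_p(D_* )=D_p+\partial D_{p+1}$. Put $H_p^{\sup}(D_*;C_* )=H_p(S_*(D_* ))$, and for graded subgroups $E_*\subseteq D_*$ put $H^{\sup}_p(D_*,E_*;C_* )=H_p(S_*(D_* )/S_*(E_* ))$. Path homology. For a finite set $X$, $\Lambda_p(X)$ is the $k$-vector space with basis $e_{x_0\cdots x_p}$ ($x_i\in X$), $p\ge0$ (zero for $p<0$), with $\overline\partial e_{x_0\cdots x_p}=\sum_i(-1)^i e_{x_0\cdots\widehat{x_i}\cdots x_p}$. A path $x_0\cdots x_p$ is regular if $x_{j-1}\ne x_j$ for all $1\le j\le p$, otherwise irregular; irregular paths span a subcomplex $\mathcal{I}_*$, and the span $\mathcal{R}_p(X)$ of regular paths is made a chain complex via $\mathcal{R}_*\cong\Lambda_*/\mathcal{I}_*$.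 For a digraph $G=(X,E)$, $\mathcal{A}_p(G)\subseteq\mathcal{R}_p(X)$ is the span of allowed regular paths, i.e. those with $(x_{j-1},x_j)\in E$ for all $1\le j\le p$. Put $H_p(G)=H_p^{\sup}(\mathcal{A}_*(G);\mathcal{R}_*(X))$, and for $G'=(X,E')$ with $E'\subseteq E$, $H_p(G,G')=H_p^{\sup}(\mathcal{A}_*(G),\mathcal{A}_*(G');\mathcal{R}_*(X))$. Extended persistence modules. Let $\mathbb{R}^o$ be $\mathbb{R}$ with reversed order, the element corresponding to $b\in\mathbb{R}$ written $\overline{b}$, and let $\mathbb{E}=\mathbb{R}\cup\{\infty\}\cup\mathbb{R}^o$ with $s<\infty<\overline{t}$ for all $s,t\in\mathbb{R}$. An extended persistence module is a functor from the poset $\mathbb{E}$ to finite dimensional $k$-vector spaces. For a weighted digraph $D=(X,E,A)$ and $a\in\mathbb{R}$, let $G=(X,E)$, $G_a=(X,\{(x,y)\in E:A(x,y)\le a\})$, $G_{\overline{a}}=(X,\{(x,y)\in E:A(x,y)\ge a\})$. The extended persistence module $V^D_p$ is defined by $V_p^D(a)=H_p(G_a)$, $V_p^D(\infty)=H_p(G)$, $V_p^D(\overline{a})=H_p(G,G_{\overline{a}})$, with maps induced by inclusions (and the corresponding projections of quotient complexes). Diagrams. For an interval $I\subseteq\mathbb{E}$, the interval module $k_I$ is $k$ on $I$ and $0$ elsewhere, with identity maps between nonzero spaces. For an extended persistence module $V$ isomorphic to a finite direct sum of interval modules (such a decomposition is unique), define multisets (counting multiplicity, regardless of whether endpoints are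 included): $\mathrm{Ord}(V)$ on $\mathbb{R}\times\mathbb{R}$ has a point $(a,a')$ for each interval with endpoints $a\le a'$ in $\mathbb{R}$; $\mathrm{Rel}(V)$ on $\mathbb{R}^o\times\mathbb{R}^o$ has a point $(\overline{b},\overline{b'})$ for each interval with endpoints $\overline{b}\le\overline{b'}$ in $\mathbb{R}^o$; $\mathrm{Ext}(V)$ on $\mathbb{R}\times\mathbb{R}^o$ has a point $(a,\overline{b})$ for each interval with endpoints $a\in\mathbb{R}$, $\overline{b}\in\mathbb{R}^o$. Only intervals of these three types contribute points. On each plane use $d((x,y),(z,w))=\max(|x-z|,|y-w|)$ (elements of $\mathbb{R}^o$ being identified with real numbers). Bottleneck distance. A partial matching between multisets $A,B$ is a bijection between sub-multisets $A'\subset A$, $B'\subset B$; it is perfect if $A'=A$, $B'=B$. For $\delta>0$, a $\delta$-matching between $V,W$ is a triple $(\phi_O,\phi_R,\phi_E)$ with $\phi_O$ a partial matching between $\mathrm{Ord}(V),\mathrm{Ord}(W)$, $\phi_R$ a partial matching between $\mathrm{Rel}(V),\mathrm{Rel}(W)$, $\phi_E$ a perfect matching between $\mathrm{Ext}(V),\mathrm{Ext}(W)$, such that all matched pairs are at distance at most $\delta$ and all unmatched points are at distance at most $\delta$ from the diagonal of their plane. $d_B(V,W)=\inf\{\delta>0: V,W\text{ are }\delta\text{-matched}\}$. *)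

(* Defs.v *)
From HB Require Import structures.
From mathcomp Require Import all_boot all_order all_algebra.
From mathcomp Require Import generic_quotient ring_quotient zify.
From mathcomp Require Import classical_sets reals ereal.
Set Implicit Arguments.
Unset Strict Implicit.
Unset Printing Implicit Defensive.
Import Order.TTheory GRing.Theory Num.Theory.
Local Open Scope ring_scope.

(* The quotient of a finite dimensional space by a subspace, as a vectType. *)
Section QuotientSpace.
Local Open Scope quotient_scope.
Variables (k : fieldType) (vT : vectType k) (W : {vspace vT}).

Definition quotv : Type := Quotient.quot (pred_of_vspace W : zmodClosed vT).

HB.instance Definition _ := GRing.Zmodule.on quotv.

Definition quotv_pi_def (v : vT) : quotv := \pi_quotv v.

Let piE u v : (quotv_pi_def u == quotv_pi_def v) = (u - v \in W).
Proof. by rewrite /quotv_pi_def -Quotient.idealrBE. Qed.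

Definition quotv_scale (a : k) (x : quotv) : quotv :=
  quotv_pi_def (a *: repr x).

Let pi_repr (x : quotv) : quotv_pi_def (repr x) = x.
Proof. exact: reprK. Qed.

Let pi_scale a v : quotv_scale a (quotv_pi_def v) = quotv_pi_def (a *: v).
Proof. by apply/eqP; rewrite piE -scalerBr memvZ// -piE pi_repr. Qed.

Let pi_add u v : quotv_pi_def (u + v) = quotv_pi_def u + quotv_pi_def v.
Proof. by rewrite /quotv_pi_def raddfD. Qed.

Fact quotv_scalerA a b x : quotv_scale a (quotv_scale b x) = quotv_scale (a * b) x.
Proof. by rewrite -[x]pi_repr !pi_scale scalerA. Qed.
Fact quotv_scale1r : left_id 1 quotv_scale.
Proof. by move=> x; rewrite -[x]pi_repr pi_scale scale1r. Qed.
Fact quotv_scalerDr : right_distributive quotv_scale +%R.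
Proof.
by move=> a x y; rewrite -[x]pi_repr -[y]pi_repr -pi_add !pi_scale scalerDr pi_add.
Qed.
Fact quotv_scalerDl x : {morph quotv_scale^~ x : a b / a + b}.
Proof. by move=> a b; rewrite -[x]pi_repr !pi_scale scalerDl pi_add. Qed.

HB.instance Definition _ := GRing.Zmodule_isLmodule.Build k quotv
  quotv_scalerA quotv_scale1r quotv_scalerDr quotv_scalerDl.

Fact quotv_pi_is_linear : linear quotv_pi_def.
Proof. by move=> a u v; rewrite pi_add -pi_scale. Qed.

HB.instance Definition _ := GRing.isLinear.Build k vT quotv _ quotv_pi_def
  quotv_pi_is_linear.

Fact quotv_vect_iso : Vector.axiom (\dim W^C) quotv.
Proof.
pose g (r : 'rV_(\dim W^C)) := quotv_pi_def (\sum_i r 0 i *: (vbasis W^C)`_i).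
pose c u := daddv_pi W^C W u.
have dC : (W^C :&: W = 0)%VS by rewrite capvC capv_compl.
have cW u : u - c u \in W.
  have := daddv_pi_add dC (_ : u \in W^C + W)%VS.
  rewrite addvC addv_complf memvf => /(_ isT) e.
  by rewrite -{1}e addrAC subrr add0r memv_pi.
pose f (x : quotv) := \row_i coord (vbasis W^C) i (c (repr x)).
have cE u v : u - v \in W -> c u = c v.
  move=> uv; apply/eqP; rewrite -subr_eq0 -memv0 -dC memv_cap.
  rewrite memvB ?memv_pi//=.
  have -> : c u - c v = (u - v) + (v - c v) - (u - c u).
    by rewrite opprB [u - v + _]addrA subrK [RHS]addrC addrA subrK.
  by rewrite memvB// memvD.
have fpi u : f (quotv_pi_def u) = \row_i coord (vbasis W^C) i (c u).
  apply/rowP=> i; rewrite !mxE; congr (coord _ _ _).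
  by apply: cE; rewrite -piE pi_repr.
exists f.
  move=> a x y; rewrite -[x]pi_repr -[y]pi_repr -quotv_pi_is_linear !fpi.
  by apply/rowP=> i; rewrite !mxE /c linearP linearP.
exists g.
  move=> x; rewrite -[x]pi_repr fpi /g; apply/eqP; rewrite piE.
  under eq_bigr do rewrite mxE.
  by rewrite -coord_vbasis ?memv_pi// -opprB memvN.
move=> r; rewrite /g fpi; apply/rowP=> i; rewrite mxE /c daddv_pi_id//.
  by rewrite coord_sum_free ?(basis_free (vbasisP _)).
by apply: rpred_sum => j _; rewrite rpredZ ?vbasis_mem ?memt_nth.
Qed.

HB.instance Definition _ := Lmodule_hasFinDim.Build k quotv quotv_vect_iso.

Definition quotv_pi : 'Hom(vT, quotv) := linfun quotv_pi_def.

Lemma limg_quotv_pi : limg quotv_pi = fullv.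
Proof.
apply/eqP; rewrite eqEsubv subvf; apply/subvP=> x _.
by rewrite -[x]pi_repr -(lfunE quotv_pi_def) memv_img ?memvf.
Qed.

Lemma lker_quotv_pi : lker quotv_pi = W.
Proof.
apply/vspaceP=> v; rewrite memv_ker lfunE -(linear0 quotv_pi_def) piE.
by rewrite subr0.
Qed.
End QuotientSpace.

Section InducedMaps.
Variables (k : fieldType).
Implicit Types vT wT : vectType k.

(* The restriction U -> U' of f; only meaningful if f maps U into U'. *)
Definition restrv vT wT (U : {vspace vT}) (U' : {vspace wT}) (f : 'Hom(vT, wT))
    : 'Hom(subvs_of U, subvs_of U') :=
  (linfun (vsproj U') \o f \o linfun vsval)%VF.

(* The map vT / W -> wT / W' induced by f; only meaningful if f maps W
   into W' (see quotvmapE). *)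
Definition quotvmap vT wT (W : {vspace vT}) (W' : {vspace wT})
    (f : 'Hom(vT, wT)) : 'Hom(quotv W, quotv W') :=
  (quotv_pi W' \o f \o (quotv_pi W)^-1)%VF.

Lemma restrvE vT wT (U : {vspace vT}) (U' : {vspace wT}) (f : 'Hom(vT, wT)) u :
  (f @: U <= U')%VS -> vsval (restrv U U' f u) = f (vsval u).
Proof.
move=> fU; rewrite !comp_lfunE !lfunE vsprojK//.
by apply: (subvP fU); rewrite memv_img// subvsP.
Qed.

Lemma mem_vsval_preim vT (U W : {vspace vT}) (u : subvs_of U) :
  (u \in linfun vsval @^-1: W)%VS = (vsval u \in W).
Proof. by rewrite -memv_preim lfunE. Qed.

Lemma quotv_pi_eq vT (W : {vspace vT}) u v :
  (quotv_pi W u == quotv_pi W v) = (u - v \in W).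
Proof. by rewrite -[W in RHS]lker_quotv_pi memv_ker linearB subr_eq0. Qed.

Lemma quotvP vT (W : {vspace vT}) (x : quotv W) : exists v, x = quotv_pi W v.
Proof.
have : x \in limg (quotv_pi W) by rewrite limg_quotv_pi memvf.
by case/memv_imgP=> v _ ->; exists v.
Qed.

Lemma quotvmapE vT wT (W : {vspace vT}) (W' : {vspace wT}) (f : 'Hom(vT, wT)) v :
  (f @: W <= W')%VS -> quotvmap W W' f (quotv_pi W v) = quotv_pi W' (f v).
Proof.
move=> fW; rewrite !comp_lfunE; apply/eqP; rewrite quotv_pi_eq -linearB.
apply: (subvP fW); rewrite memv_img// -quotv_pi_eq limg_lfunVK//.
by rewrite limg_quotv_pi memvf.
Qed.

End InducedMaps.

(* Nonnegatively graded complexes; the differential out of degree 0 is zero. *)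
Record chain_complex (k : fieldType) := ChainComplex {
  cc_obj :> nat -> vectType k;
  cc_d : forall n, 'Hom(cc_obj n.+1, cc_obj n);
  cc_dd : forall n, (cc_d n \o cc_d n.+1 = 0)%VF }.

Section Complexes.
Variable (k : fieldType).
Implicit Types C : chain_complex k.

Definition graded_subgroup C := forall n, {vspace C n}.

Record subcomplex C := Subcomplex {
  sc_obj :> forall n, {vspace C n};
  sc_stable : forall n, (cc_d C n @: sc_obj n.+1 <= sc_obj n)%VS }.

Definition graded_map C C' := forall n, 'Hom(C n, C' n).

Definition is_chain_map C C' (f : graded_map C C') :=
  forall n, (f n \o cc_d C n = cc_d C' n \o f n.+1)%VF.

Section Sub.
Variables (C : chain_complex k) (S : subcomplex C).

Fact sub_cc_dd n : (restrv (S n.+1) (S n) (cc_d C n) \o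
  restrv (S n.+2) (S n.+1) (cc_d C n.+1) = 0)%VF.
Proof.
apply/lfunP=> u; apply: subvs_inj.
rewrite comp_lfunE !restrvE ?sc_stable// -comp_lfunE cc_dd.
by rewrite !lfunE.
Qed.

Definition sub_cc : chain_complex k :=
  ChainComplex (cc_obj := fun n => subvs_of (S n)) sub_cc_dd.

Fact quot_cc_dd n : (quotvmap (S n.+1) (S n) (cc_d C n) \o
  quotvmap (S n.+2) (S n.+1) (cc_d C n.+1) = 0)%VF.
Proof.
apply/lfunP=> x; have [v ->] := quotvP x.
rewrite comp_lfunE !quotvmapE ?sc_stable// -(comp_lfunE (cc_d C n)) cc_dd.
by rewrite !zero_lfunE linear0.
Qed.

Definition quot_cc : chain_complex k :=
  ChainComplex (cc_obj := fun n => quotv (S n)) quot_cc_dd.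

End Sub.

Definition cycles C n : {vspace C n} :=
  if n is m.+1 then lker (cc_d C m) else fullv.

Definition boundaries C n : {vspace C n} := limg (cc_d C n).

(* The boundaries as a subspace of the space of cycles. *)
Definition boundaries_in_cycles C n : {vspace subvs_of (cycles C n)} :=
  (linfun vsval @^-1: boundaries C n)%VS.

Definition homology C n : vectType k := quotv (boundaries_in_cycles C n).

Definition homology_map C C' (f : graded_map C C') n :
    'Hom(homology C n, homology C' n) :=
  quotvmap (boundaries_in_cycles C n) (boundaries_in_cycles C' n)
    (restrv (cycles C n) (cycles C' n) (f n)).

Lemma chain_map_cycles C C' (f : graded_map C C') n :
  is_chain_map f -> (f n @: cycles C n <= cycles C' n)%VS.
Proof.
move=> fC; case: n => [|n]; first by rewrite subvf.
apply/subvP=> _ /memv_imgP[u uZ ->]; move: uZ; rewrite /= !memv_ker => /eqP du.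
by rewrite -comp_lfunE -fC comp_lfunE du linear0.
Qed.

Lemma chain_map_boundaries C C' (f : graded_map C C') n : is_chain_map f ->
  (restrv (cycles C n) (cycles C' n) (f n) @: boundaries_in_cycles C n
     <= boundaries_in_cycles C' n)%VS.
Proof.
move=> fC; apply/subvP=> _ /memv_imgP[u uB ->].
move: uB; rewrite !mem_vsval_preim restrvE ?chain_map_cycles// => /memv_imgP[v _ ->].
by rewrite -comp_lfunE fC comp_lfunE memv_img ?memvf.
Qed.

Lemma homology_map_id C n :
  homology_map (fun n => \1%VF : 'Hom(C n, C n)) n = \1%VF.
Proof.
have idC : is_chain_map (fun n => \1%VF : 'Hom(C n, C n)).
  by move=> m; rewrite comp_lfun1l comp_lfun1r.
apply/lfunP=> x; have [v ->] := quotvP x.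
rewrite [RHS]id_lfunE /homology_map quotvmapE ?(chain_map_boundaries n idC)//.
congr (quotv_pi _ _); apply: subvs_inj.
by rewrite restrvE ?lim1g// id_lfunE.
Qed.

Lemma homology_map_comp C C' C'' (g : graded_map C' C'') (f : graded_map C C') n :
  is_chain_map g -> is_chain_map f ->
  homology_map (fun n => g n \o f n)%VF n =
  (homology_map g n \o homology_map f n)%VF.
Proof.
move=> gC fC.
have gfC : is_chain_map (fun n => g n \o f n)%VF.
  by move=> m; rewrite -comp_lfunA fC comp_lfunA gC comp_lfunA.
apply/lfunP=> x; have [v ->] := quotvP x.
rewrite [RHS]comp_lfunE /homology_map !quotvmapE ?chain_map_boundaries ?(chain_map_boundaries n gfC)//.
congr (quotv_pi _ _); apply: subvs_inj.
rewrite !restrvE ?chain_map_cycles ?(chain_map_cycles n gfC)//.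
by rewrite comp_lfunE.
Qed.

Lemma eq_homology_map C C' (f g : graded_map C C') n :
  f n = g n -> homology_map f n = homology_map g n.
Proof. by rewrite /homology_map => ->. Qed.

Section Supremum.
Variable C : chain_complex k.
Implicit Types D N : graded_subgroup C.

Definition sup_obj D : graded_subgroup C :=
  fun n => (D n + cc_d C n @: D n.+1)%VS.

Fact sup_stable D n : (cc_d C n @: sup_obj D n.+1 <= sup_obj D n)%VS.
Proof.
rewrite /sup_obj limgD subv_add addvSr -limg_comp cc_dd lim0g.
exact: sub0v.
Qed.

Definition sup_subcomplex D := Subcomplex (sup_stable D).

Definition sup_complex D : chain_complex k := sub_cc (sup_subcomplex D).

Definition sup_homology D p : vectType k := homology (sup_complex D) p.

(* S_*(N) seen inside S_*(D); the intended use is for N contained in D. *)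
Definition sup_trace_obj D N : graded_subgroup (sup_complex D) :=
  fun n => (linfun vsval @^-1: sup_obj N n)%VS.

Fact sup_trace_stable D N n :
  (cc_d (sup_complex D) n @: sup_trace_obj D N n.+1 <= sup_trace_obj D N n)%VS.
Proof.
apply/subvP=> _ /memv_imgP[u uN ->]; move: uN.
rewrite !mem_vsval_preim restrvE ?sup_stable// => uN.
by apply: (subvP (sup_stable N n)); rewrite memv_img.
Qed.

Definition sup_trace D N : subcomplex (sup_complex D) :=
  Subcomplex (sup_trace_stable D N).

Definition rel_sup_complex D N : chain_complex k := quot_cc (sup_trace D N).

Definition rel_sup_homology D N p : vectType k :=
  homology (rel_sup_complex D N) p.

(* Inclusions S_*(D) -> S_*(D'), projections S_*(D) -> S_*(D) / S_*(N), and
   maps S_*(D) / S_*(N) -> S_*(D') / S_*(N') induced by the inclusion; only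
   meaningful for D contained in D' and N contained in N'. *)
Definition sup_incl D D' : graded_map (sup_complex D) (sup_complex D') :=
  fun n => restrv (sup_obj D n) (sup_obj D' n) \1%VF.

Definition sup_proj D N : graded_map (sup_complex D) (rel_sup_complex D N) :=
  fun n => quotv_pi (sup_trace_obj D N n).

Definition rel_sup_incl D N D' N' :
    graded_map (rel_sup_complex D N) (rel_sup_complex D' N') :=
  fun n => quotvmap (sup_trace_obj D N n) (sup_trace_obj D' N' n)
             (sup_incl D D' n).

Definition graded_sub D D' := forall n, (D n <= D' n)%VS.

Lemma sup_objS D D' n : graded_sub D D' -> (sup_obj D n <= sup_obj D' n)%VS.
Proof. by move=> DD'; rewrite addvS ?limgS. Qed.

Lemma sup_inclE D D' n u :
  graded_sub D D' -> vsval (sup_incl D D' n u) = vsval u.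
Proof. by move=> DD'; rewrite restrvE ?lim1g ?sup_objS// id_lfunE. Qed.

Lemma sup_incl_id D n : sup_incl D D n = \1%VF.
Proof. by apply/lfunP=> u; apply: subvs_inj; rewrite sup_inclE// id_lfunE. Qed.

Lemma sup_incl_comp D D' D'' n : graded_sub D D' -> graded_sub D' D'' ->
  (sup_incl D' D'' n \o sup_incl D D' n)%VF = sup_incl D D'' n.
Proof.
move=> s1 s2; have s3 : graded_sub D D'' by move=> m; apply: subv_trans (s2 m).
apply/lfunP=> u; apply: subvs_inj.
by rewrite (comp_lfunE (sup_incl D' D'' n)) !sup_inclE.
Qed.

Lemma sup_incl_chain D D' : graded_sub D D' -> is_chain_map (sup_incl D D').
Proof.
move=> s n; apply/lfunP=> u; apply: subvs_inj.
rewrite (comp_lfunE (sup_incl D D' n)) (comp_lfunE (cc_d (sup_complex D') n)).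
rewrite (sup_inclE _ s) (restrvE _ (sup_stable D n)).
by rewrite (restrvE _ (sup_stable D' n)) (sup_inclE _ s).
Qed.

Lemma sup_proj_chain D N : is_chain_map (sup_proj D N).
Proof.
move=> n; apply/lfunP=> u; rewrite (comp_lfunE (sup_proj D N n)).
by rewrite [RHS]comp_lfunE quotvmapE// sup_trace_stable.
Qed.

Lemma rel_sup_inclE D N D' N' n u : graded_sub D D' -> graded_sub N N' ->
  rel_sup_incl D N D' N' n (sup_proj D N n u) =
  sup_proj D' N' n (sup_incl D D' n u).
Proof.
move=> sD sN; rewrite /rel_sup_incl quotvmapE//.
apply/subvP=> _ /memv_imgP[v vN ->]; move: vN.
rewrite !mem_vsval_preim sup_inclE//.
exact: (subvP (sup_objS _ sN)).
Qed.

End Supremum.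

End Complexes.

Section PathComplex.
Variables (k : fieldType) (X : finType).

(* Lambda_p(X), with basis lam_e x for x a sequence of p + 1 vertices. *)
Definition Lam p : vectType k := {ffun (p.+1).-tuple X -> k^o}.

Definition lam_e p (x : (p.+1).-tuple X) : Lam p :=
  [ffun y => (y == x)%:R : k^o].

Definition face p (i : 'I_p.+2) (x : (p.+2).-tuple X) : (p.+1).-tuple X :=
  [tuple tnth x (lift i j) | j < p.+1].

Definition lam_bd_fun p (u : Lam p.+1) : Lam p :=
  \sum_x u x *: \sum_(i < p.+2) (-1) ^+ i *: lam_e (face i x).

Fact lam_bd_is_linear p : linear (@lam_bd_fun p).
Proof.
move=> a u v; rewrite /lam_bd_fun scaler_sumr -big_split; apply: eq_bigr => x _.
by rewrite !ffunE scalerDl scalerA.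
Qed.

HB.instance Definition _ p :=
  GRing.isLinear.Build k (Lam p.+1) (Lam p) _ (@lam_bd_fun p)
    (@lam_bd_is_linear p).

Definition lam_bd p : 'Hom(Lam p.+1, Lam p) := linfun (@lam_bd_fun p).

Lemma lam_sum p (u : Lam p) : u = \sum_x u x *: lam_e x.
Proof.
apply/ffunP=> y; rewrite sum_ffunE (bigD1 y)//= !ffunE eqxx big1 ?addr0.
  by rewrite /GRing.scale /= mulr1.
by move=> x; rewrite !ffunE eq_sym => /negPf->; rewrite scaler0.
Qed.

Lemma lam_bdE p (x : (p.+2).-tuple X) :
  lam_bd p (lam_e x) = \sum_(i < p.+2) (-1) ^+ i *: lam_e (face i x).
Proof.
rewrite lfunE /= /lam_bd_fun (bigD1 x)//= ffunE eqxx scale1r [X in _ + X]big1 ?addr0//.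
by move=> y /negPf; rewrite ffunE => ->; rewrite scale0r.
Qed.

Lemma lam_eq p (vT : vectType k) (f g : 'Hom(Lam p, vT)) :
  (forall x, f (lam_e x) = g (lam_e x)) -> f = g.
Proof.
move=> fg; apply/lfunP=> u; rewrite (lam_sum u) !linear_sum.
by apply: eq_bigr => x _; rewrite !linearZ /= fg.
Qed.

Fact lam_dd p : (lam_bd p \o lam_bd p.+1 = 0)%VF.
Proof.
apply: lam_eq => x; rewrite comp_lfunE zero_lfunE lam_bdE linear_sum.
pose F (q : 'I_p.+3 * 'I_p.+2) : Lam p :=
  (-1) ^+ (q.1 + q.2) *: lam_e (face q.2 (face q.1 x)).
transitivity (\sum_q F q).
  rewrite -(pair_big xpredT xpredT (fun i j => F (i, j))) /=.
  apply: eq_bigr => i _; rewrite linearZ /= lam_bdE scaler_sumr.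
  by apply: eq_bigr => j _; rewrite scalerA -exprD.
rewrite (bigID (fun q : 'I_p.+3 * 'I_p.+2 => q.2 < q.1)%N) /=.
pose h (q : 'I_p.+3 * 'I_p.+2) : 'I_p.+3 * 'I_p.+2 :=
  (lift q.1 q.2, inord q.1).
pose h' (q : 'I_p.+3 * 'I_p.+2) : 'I_p.+3 * 'I_p.+2 :=
  (inord q.2, inord q.1.-1).
rewrite (reindex_onto h h') /=; last first.
  case=> i j /= ji; have := ltn_ord i; have := ltn_ord j => lj li.
  rewrite /h /h' /=; congr pair; apply: val_inj => /=.
    by rewrite !inordK /bump; lia.
  by rewrite inordK /=; rewrite inordK; lia.
apply/eqP; rewrite addr_eq0 -sumrN; apply/eqP; apply: eq_big => [[i j]|[i j]] /=.
  have := ltn_ord i; have := ltn_ord j => lj li.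
  have [ji|ij] := ltnP j i.
    have bij : bump i j = j by rewrite /bump leqNgt ji.
    apply/negbTE; rewrite negb_and bij -leqNgt.
    have [lip|ipl] := ltnP i p.+2; first by rewrite inordK// (ltnW ji).
    apply/orP; right; apply/eqP => -[/(congr1 val) /= + _].
    have -> : nat_of_ord (inord i : 'I_p.+2) = 0%N.
      by rewrite -[LHS]/(val (insubd _ _)) val_insubd ltnNge ipl.
    by rewrite inordK// => ie; move: ji; rewrite -ie.
  have bij : bump i j = j.+1 by rewrite /bump ij.
  rewrite bij inordK ?(leq_ltn_trans ij lj)// ltnS ij /=; apply/eqP.
  congr pair; apply: val_inj => /=; last by rewrite bij inordK.
  by rewrite !inordK ?(leq_ltn_trans ij lj).
case/andP=> lt_hij /eqP[hi _].
have ei : nat_of_ord (inord i : 'I_p.+2) = i.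
  by rewrite -[RHS](congr1 val hi) [RHS]inordK// (ltn_trans (ltn_ord _)).
have ij : (i <= j)%N.
  by rewrite leqNgt; apply/negP=> ji; move: lt_hij;
    rewrite ei /bump [(i <= j)%N]leqNgt ji ltnNge (ltnW ji).
rewrite /F /h /= ei /bump ij add1n addSn exprS mulN1r scaleNr [(i + j)%N]addnC.
congr (- (_ *: lam_e _)); apply: eq_from_tnth => l; rewrite !tnth_mktuple.
congr (tnth x _); apply: val_inj; rewrite /= ei /bump.
by move: ij; case: (leqP i l); case: (leqP j l) => /=; lia.
Qed.

Definition path_chains : chain_complex k := ChainComplex lam_dd.

Definition regular p (x : (p.+1).-tuple X) : bool :=
  sorted (fun u v => u != v) x.

Lemma irregularP p (x0 : X) (x : (p.+1).-tuple X) :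
  reflect (exists2 l, (l < p)%N & nth x0 x l = nth x0 x l.+1) (~~ regular x).
Proof.
apply: (iffP idP) => [|[l lp xl]].
  move=> xirr; have /existsP[l /eqP xl] :
      [exists l : 'I_p, nth x0 x l == nth x0 x l.+1].
    apply: contraNT xirr; rewrite negb_exists => /forallP xreg.
    apply/(sortedP x0) => l; rewrite size_tuple ltnS => lp.
    exact: (xreg (Ordinal lp)).
  by exists l.
apply/negP => /(sortedP x0)/(_ l); rewrite size_tuple ltnS => /(_ lp).
by rewrite xl eqxx.
Qed.

Lemma nth_face p (x0 : X) (i : 'I_p.+2) (x : (p.+2).-tuple X) l :
  (l < p.+1)%N -> nth x0 (face i x) l = nth x0 x (bump i l).
Proof.
move=> lp; rewrite -[l]/(nat_of_ord (Ordinal lp)) -tnth_nth tnth_mktuple.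
by rewrite (tnth_nth x0).
Qed.

Definition irregular_obj : graded_subgroup path_chains :=
  fun p => <<[seq lam_e x | x in [pred x : (p.+1).-tuple X | ~~ regular x]]>>%VS.

Fact irregular_stable p :
  (cc_d path_chains p @: irregular_obj p.+1 <= irregular_obj p)%VS.
Proof.
rewrite limg_span; apply/span_subvP => v /mapP[u + ->].
move=> /mapP[x]; rewrite mem_enum inE => xirr ->.
have /(irregularP (thead x))[j jp xj] := xirr.
rewrite /= lam_bdE.
pose i0 : 'I_p.+2 := inord j; pose i1 : 'I_p.+2 := inord j.+1.
have e0 : nat_of_ord i0 = j by rewrite inordK// ltnW.
have e1 : nat_of_ord i1 = j.+1 by rewrite inordK.
have i10 : i1 != i0 by rewrite -val_eqE /= e0 e1 neq_ltn ltnSn orbT.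
rewrite (bigD1 i0)//= (bigD1 i1)//= addrA.
have -> : face i1 x = face i0 x.
  apply: val_inj; apply: (@eq_from_nth _ (thead x)); rewrite ?size_tuple// => l lp.
  rewrite !nth_face// e0 e1 /bump.
  case: (ltngtP j l) => jl; rewrite ?add0n ?add1n//=.
  by rewrite -jl xj.
rewrite e0 e1 exprS mulN1r scaleNr addrN add0r.
apply: rpred_sum => i /andP[ii0 ii1]; apply: rpredZ; apply: memv_span.
apply: map_f; rewrite mem_enum inE.
apply/(irregularP (thead x)).
rewrite -val_eqE /= e0 in ii0; rewrite -val_eqE /= e1 in ii1.
have [ij|ji] := ltnP i j.
  exists j.-1; first by lia.
  rewrite !nth_face; try lia.
  have -> : bump i j.-1 = j by rewrite /bump; lia.
  by have -> : bump i j.-1.+1 = j.+1 by rewrite /bump; lia.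
have li := ltn_ord i; exists j; first by lia.
rewrite !nth_face; try lia.
have -> : bump i j = j by rewrite /bump; lia.
by have -> : bump i j.+1 = j.+1 by rewrite /bump; lia.
Qed.

Definition irregular_chains : subcomplex path_chains :=
  Subcomplex irregular_stable.

(* R_*(X) is taken to be Lambda_*(X) / I_*(X); the basis element of R_p(X)
   given by a regular path x is reg_e x. *)
Definition regular_chains : chain_complex k := quot_cc irregular_chains.

Definition reg_e p (x : (p.+1).-tuple X) : regular_chains p :=
  quotv_pi (irregular_obj p) (lam_e x).

Definition allowed (E : {set X * X}) p (x : (p.+1).-tuple X) : bool :=
  sorted (fun u v => (u, v) \in E) x.

Definition allowed_chains (E : {set X * X}) : graded_subgroup regular_chains :=
  fun p => <<[seq reg_e x | x in
    [pred x : (p.+1).-tuple X | regular x && allowed E x]]>>%VS.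

Lemma allowed_chainsS (E E' : {set X * X}) :
  E \subset E' -> graded_sub (allowed_chains E) (allowed_chains E').
Proof.
move=> /fintype.subsetP sE p; apply/span_subvP => v /mapP[x].
rewrite mem_enum inE => /andP[xr xa] ->; apply/memv_span/map_f.
rewrite mem_enum inE xr /=; apply: sub_sorted xa => u w; exact: sE.
Qed.

End PathComplex.

(* The extended real line: R, then infinity, then R with reversed order. *)
Section ExtendedLine.
Variable R : realType.

Inductive ext_line := Fwd of R | Infty | Bwd of R.

Definition ext_line_code (t : ext_line) : R + (unit + R) :=
  match t with Fwd a => inl a | Infty => inr (inl tt) | Bwd b => inr (inr b) end.

Definition ext_line_decode (c : R + (unit + R)) : ext_line :=
  match c with inl a => Fwd a | inr (inl _) => Infty | inr (inr b) => Bwd b end.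

Fact ext_line_codeK : cancel ext_line_code ext_line_decode.
Proof. by case. Qed.

HB.instance Definition _ := Choice.copy ext_line (can_type ext_line_codeK).

Definition ext_le (s t : ext_line) : bool :=
  match s, t with
  | Fwd a, Fwd a' => a <= a'
  | Fwd _, _ => true
  | Infty, Fwd _ => false
  | Infty, _ => true
  | Bwd b, Bwd b' => b' <= b
  | Bwd _, _ => false
  end.

Definition ext_lt (s t : ext_line) : bool := (t != s) && ext_le s t.

Fact ext_le_anti : antisymmetric ext_le.
Proof.
move=> [a||b] [a'||b'] //= ab; congr (_ _); apply/le_anti => //.
by rewrite andbC.
Qed.

Fact ext_le_trans : transitive ext_le.
Proof.
move=> [a'||b'] [a||b] [a''||b''] //=; first exact: le_trans.
by move=> ? /le_trans; apply.
Qed.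

Fact ext_le_total : total ext_le.
Proof. by move=> [a||b] [a'||b'] //=; apply: le_total. Qed.

Fact ext_display : Order.disp_t. Proof. exact: Order.Disp tt tt. Qed.

HB.instance Definition _ := Order.isOrder.Build ext_display ext_line
  (fun _ _ => erefl) (fun _ _ => erefl) (fun _ _ => erefl)
  ext_le_anti ext_le_trans ext_le_total.

End ExtendedLine.
Arguments Infty {R}.

Record pers_mod d (P : porderType d) (k : fieldType) := PersMod {
  pm_obj :> P -> vectType k;
  pm_map : forall s t, (s <= t)%O -> 'Hom(pm_obj s, pm_obj t);
  pm_map_id : forall s (ss : (s <= s)%O), pm_map ss = \1%VF;
  pm_map_comp : forall s t u (st : (s <= t)%O) (tu : (t <= u)%O)
    (su : (s <= u)%O), pm_map su = (pm_map tu \o pm_map st)%VF }.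

Section PersistenceModules.
Variables (d : Order.disp_t) (k : fieldType).

Definition pm_iso (P : porderType d) (V W : pers_mod P k) : Prop :=
  exists f : forall s, 'Hom(V s, W s),
    (forall s, bijective (f s)) /\
    (forall s t (st : (s <= t)%O),
       (f t \o pm_map V st = pm_map W st \o f s)%VF).

Section DirectSum.
Variables (P : porderType d).

Definition pm_zero : pers_mod P k :=
  PersMod (pm_obj := fun _ => 'rV[k]_0) (fun _ _ => erefl \1%VF)
    (fun _ _ _ _ _ _ => esym (comp_lfun1l \1)).

Variables (V W : pers_mod P k).

Definition pm_sum_map_fun s t (st : (s <= t)%O) (v : V s * W s) : V t * W t :=
  (pm_map V st v.1, pm_map W st v.2).

Fact pm_sum_map_is_linear s t (st : (s <= t)%O) : linear (pm_sum_map_fun st).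
Proof. by move=> a u v; rewrite /pm_sum_map_fun !linearP. Qed.

HB.instance Definition _ s t (st : (s <= t)%O) :=
  GRing.isLinear.Build k (V s * W s)%type (V t * W t)%type _
    (pm_sum_map_fun st) (pm_sum_map_is_linear st).

Fact pm_sum_map_id s (ss : (s <= s)%O) : linfun (pm_sum_map_fun ss) = \1%VF.
Proof.
by apply/lfunP=> -[v w]; rewrite !lfunE /= /pm_sum_map_fun !pm_map_id !id_lfunE.
Qed.

Fact pm_sum_map_comp s t u (st : (s <= t)%O) (tu : (t <= u)%O) (su : (s <= u)%O) :
  linfun (pm_sum_map_fun su) =
  (linfun (pm_sum_map_fun tu) \o linfun (pm_sum_map_fun st))%VF.
Proof.
apply/lfunP=> -[v w]; rewrite comp_lfunE !lfunE /= /pm_sum_map_fun.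
by rewrite !(pm_map_comp _ st tu) !comp_lfunE.
Qed.

Definition pm_sum : pers_mod P k :=
  PersMod (pm_obj := fun s => (V s * W s)%type) pm_sum_map_id pm_sum_map_comp.

End DirectSum.

Section IntervalModule.
Variables (P : orderType d) (I : interval P).

(* 'rV_(s \in I) is k if s is in I and 0 otherwise; const_mx 1 is then the
   identity of k or the zero map. *)
Definition interval_map s t :
    'Hom('rV[k]_(s \in I) : vectType k, 'rV[k]_(t \in I) : vectType k) :=
  linfun (mulmxr (const_mx 1 : 'M[k]_(s \in I, t \in I))).

Fact interval_map_id s : (s <= s)%O -> interval_map s s = \1%VF.
Proof.
move=> _; apply/lfunP=> v; rewrite !lfunE /=.
case: (s \in I) v => v; last by rewrite [LHS]thinmx0 [RHS]thinmx0.
by rewrite [const_mx 1]mx11_scalar mxE mulmx1.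
Qed.

Fact interval_map_comp s t u : (s <= t)%O -> (t <= u)%O -> (s <= u)%O ->
  interval_map s u = (interval_map t u \o interval_map s t)%VF.
Proof.
move=> st tu _; apply/lfunP=> v; rewrite comp_lfunE !lfunE /= -mulmxA.
congr (_ *m _); apply/matrixP=> i j; rewrite !mxE.
have sI : s \in I by case: (s \in I) i => // -[].
have uI : u \in I by case: (u \in I) j => // -[].
have tI : t \in I.
  move: sI uI; case: I => b1 b2; rewrite !itv_boundlr => /andP[b1s _] /andP[_ ub2].
  by rewrite (le_trans b1s) ?bnd_simp// (le_trans _ ub2) ?bnd_simp.
under eq_bigr do rewrite !mxE mulr1.
by rewrite tI big_ord1.
Qed.

Definition interval_mod : pers_mod P k :=
  PersMod (pm_obj := fun s => 'rV[k]_(s \in I)) interval_map_id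
    interval_map_comp.

End IntervalModule.
End PersistenceModules.

Record weighted_digraph (R : realType) (X : finType) := WeightedDigraph {
  wd_edges : {set X * X};
  wd_loopless : forall x, (x, x) \notin wd_edges;
  wd_weight : {e | e \in wd_edges} -> R }.

(* The maximum over the empty edge set is 0. *)
Definition weight_dist (R : realType) (X : finType) (E : {set X * X})
    (A A' : {e | e \in E} -> R) : R :=
  \big[Num.max/0]_e `|A e - A' e|.

Section PathHomology.
Variables (k : fieldType) (X : finType).

Definition path_complex (E : {set X * X}) : chain_complex k :=
  sup_complex (allowed_chains k E).

Definition path_homology E p : vectType k := homology (path_complex E) p.

Definition rel_path_complex (E E' : {set X * X}) : chain_complex k :=
  rel_sup_complex (allowed_chains k E) (allowed_chains k E').

Definition rel_path_homology E E' p : vectType k :=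
  homology (rel_path_complex E E') p.

Definition path_incl E E' : graded_map (path_complex E) (path_complex E') :=
  sup_incl (allowed_chains k E) (allowed_chains k E').

Definition path_proj E E' : graded_map (path_complex E) (rel_path_complex E E') :=
  sup_proj (allowed_chains k E) (allowed_chains k E').

Definition rel_path_incl E E1 E2 :
    graded_map (rel_path_complex E E1) (rel_path_complex E E2) :=
  rel_sup_incl (allowed_chains k E) (allowed_chains k E1)
    (allowed_chains k E) (allowed_chains k E2).

Section Extended.
Variables (R : realType) (D : weighted_digraph R X).
Let E := wd_edges D.

Definition sublevel (a : R) : {set X * X} :=
  [set val e | e : {e | e \in E} & wd_weight e <= a].

Definition superlevel (a : R) : {set X * X} :=
  [set val e | e : {e | e \in E} & a <= wd_weight e].

Definition ext_complex (t : ext_line R) : chain_complex k :=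
  match t with
  | Fwd a => path_complex (sublevel a)
  | Infty => path_complex E
  | Bwd b => rel_path_complex E (superlevel b)
  end.

(* Only meaningful for s <= t; the remaining cases are filled in with 0. *)
Definition ext_complex_map (s t : ext_line R) :
    graded_map (ext_complex s) (ext_complex t) :=
  match s, t return graded_map (ext_complex s) (ext_complex t) with
  | Fwd a, Fwd a' => path_incl (sublevel a) (sublevel a')
  | Fwd a, Infty => path_incl (sublevel a) E
  | Fwd a, Bwd b =>
      fun n => (path_proj E (superlevel b) n \o path_incl (sublevel a) E n)%VF
  | Infty, Infty => path_incl E E
  | Infty, Bwd b => path_proj E (superlevel b)
  | Bwd b, Bwd b' => rel_path_incl E (superlevel b) (superlevel b')
  | _, _ => fun n => 0
  end.

Lemma sublevel_edges a : sublevel a \subset E.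
Proof. by apply/fintype.subsetP=> _ /imsetP[e _ ->]; apply: valP. Qed.

Lemma superlevel_edges a : superlevel a \subset E.
Proof. by apply/fintype.subsetP=> _ /imsetP[e _ ->]; apply: valP. Qed.

Lemma sublevelS a a' : a <= a' -> sublevel a \subset sublevel a'.
Proof.
move=> aa'; apply: imsetS; apply/fintype.subsetP=> e; rewrite !inE => ea.
exact: le_trans aa'.
Qed.

Lemma superlevelS b b' : b' <= b -> superlevel b \subset superlevel b'.
Proof.
move=> bb'; apply: imsetS; apply/fintype.subsetP=> e; rewrite !inE.
exact: le_trans.
Qed.

(* Each ext_complex t is a quotient of the path complex of ext_edges t, which
   is used below to check the functor laws. *)
Definition ext_edges (t : ext_line R) : {set X * X} :=
  if t is Fwd a then sublevel a else E.

Definition ext_cover (t : ext_line R) :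
    graded_map (path_complex (ext_edges t)) (ext_complex t) :=
  match t return graded_map (path_complex (ext_edges t)) (ext_complex t) with
  | Fwd a => fun n => \1%VF
  | Infty => fun n => \1%VF
  | Bwd b => path_proj E (superlevel b)
  end.

Lemma ext_cover_surj t n (x : ext_complex t n) :
  exists u, x = ext_cover t n u.
Proof.
case: t x => [a||b] x /=; try by exists x; rewrite id_lfunE.
exact: quotvP.
Qed.

Lemma ext_cover_chain t : is_chain_map (ext_cover t).
Proof.
case: t => [a||b]; last exact: sup_proj_chain.
- by move=> n; rewrite comp_lfun1l comp_lfun1r.
- by move=> n; rewrite comp_lfun1l comp_lfun1r.
Qed.

Lemma ext_edgesS s t : (s <= t)%O -> ext_edges s \subset ext_edges t.
Proof.
case: s t => [a||b] [a'||b'] //= st; rewrite ?sublevel_edges//.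
exact: sublevelS.
Qed.

Lemma ext_chainsS s t : (s <= t)%O ->
  graded_sub (allowed_chains k (ext_edges s)) (allowed_chains k (ext_edges t)).
Proof. by move=> st; apply/allowed_chainsS/ext_edgesS. Qed.

Lemma ext_complex_mapE s t n u : (s <= t)%O ->
  ext_complex_map s t n (ext_cover s n u) =
  ext_cover t n (path_incl (ext_edges s) (ext_edges t) n u).
Proof.
have subE : graded_sub (allowed_chains k E) (allowed_chains k E) by [].
case: s t u => [a||b] [a'||b'] //= u st; rewrite ?id_lfunE//.
- by rewrite comp_lfunE.
- by rewrite [in RHS]/path_incl sup_incl_id id_lfunE.
- exact: rel_sup_inclE subE (allowed_chainsS k (superlevelS st)).
Qed.

Lemma ext_complex_map_chain s t : (s <= t)%O -> is_chain_map (ext_complex_map s t).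
Proof.
move=> st n; apply/lfunP=> x; have [u ->] := ext_cover_surj x.
rewrite [LHS]comp_lfunE [RHS]comp_lfunE.
rewrite -(comp_lfunE (cc_d (ext_complex s) n)) -ext_cover_chain comp_lfunE.
rewrite !ext_complex_mapE// -(comp_lfunE (cc_d (ext_complex t) n)).
rewrite -ext_cover_chain comp_lfunE; congr (ext_cover t n _).
rewrite -(comp_lfunE (path_incl _ _ n)) sup_incl_chain ?comp_lfunE//.
exact: ext_chainsS.
Qed.

Lemma ext_complex_map_id s n : (s <= s)%O -> ext_complex_map s s n = \1%VF.
Proof.
move=> ss; apply/lfunP=> x; have [u ->] := ext_cover_surj x.
by rewrite ext_complex_mapE// /path_incl sup_incl_id !id_lfunE.
Qed.

Lemma ext_complex_map_comp s t u n : (s <= t)%O -> (t <= u)%O -> (s <= u)%O ->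
  ext_complex_map s u n = (ext_complex_map t u n \o ext_complex_map s t n)%VF.
Proof.
move=> st tu su; apply/lfunP=> x; have [v ->] := ext_cover_surj x.
rewrite [RHS]comp_lfunE !ext_complex_mapE//; congr (ext_cover u n _).
rewrite -(comp_lfunE (path_incl _ _ n)); congr (fun_of_lfun _ v).
by apply/esym/sup_incl_comp; apply: ext_chainsS.
Qed.

Variable p : nat.

Fact ext_path_map_id s : (s <= s)%O ->
  homology_map (ext_complex_map s s) p = \1%VF.
Proof.
move=> ss; rewrite -homology_map_id; apply: eq_homology_map.
exact: ext_complex_map_id.
Qed.

Fact ext_path_map_comp s t u : (s <= t)%O -> (t <= u)%O -> (s <= u)%O ->
  homology_map (ext_complex_map s u) p =
  (homology_map (ext_complex_map t u) p \o
   homology_map (ext_complex_map s t) p)%VF.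
Proof.
move=> st tu su; rewrite -homology_map_comp; try exact: ext_complex_map_chain.
by apply: eq_homology_map; apply: ext_complex_map_comp.
Qed.

Definition ext_path_module : pers_mod (ext_line R) k :=
  PersMod (pm_obj := fun t => homology (ext_complex t) p)
    ext_path_map_id ext_path_map_comp.

End Extended.
End PathHomology.

Section Bottleneck.
Variables (R : realType) (k : fieldType).

(* The order on ext_line R is that of the real line, hence its nonempty
   order-convex subsets are the nonempty members of interval (ext_line R), and
   each is represented by a unique pair of bounds. *)
Definition is_barcode (V : pers_mod (ext_line R) k)
    (B : seq (interval (ext_line R))) : Prop :=
  (forall I, I \in B -> exists t, t \in I) /\
  pm_iso V (foldr (fun I W => pm_sum (interval_mod k I) W) (pm_zero k _) B).

(* Multisets are sequences up to perm_eq; R^o is identified with R. *)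
Definition Ord (B : seq (interval (ext_line R))) : seq (R * R) :=
  pmap (fun I => if I is Interval (BSide _ (Fwd a)) (BSide _ (Fwd a'))
                 then Some (a, a') else None) B.

Definition Rel (B : seq (interval (ext_line R))) : seq (R * R) :=
  pmap (fun I => if I is Interval (BSide _ (Bwd b)) (BSide _ (Bwd b'))
                 then Some (b, b') else None) B.

Definition Ext (B : seq (interval (ext_line R))) : seq (R * R) :=
  pmap (fun I => if I is Interval (BSide _ (Fwd a)) (BSide _ (Bwd b))
                 then Some (a, b) else None) B.

Definition plane_dist (x y : R * R) : R :=
  Num.max `|x.1 - y.1| `|x.2 - y.2|.

Definition diag_dist (x : R * R) : R :=
  inf [set plane_dist x (z, z) | z in [set: R]].

(* A partial matching of A and B: M lists the matched pairs, UA and UB the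
   unmatched points of A and of B. *)
Definition partial_matching (A B : seq (R * R)) (M : seq ((R * R) * (R * R)))
    (UA UB : seq (R * R)) : Prop :=
  perm_eq A (unzip1 M ++ UA) /\ perm_eq B (unzip2 M ++ UB).

Definition perfect_matching (A B : seq (R * R)) (M : seq ((R * R) * (R * R))) :
    Prop := partial_matching A B M [::] [::].

Definition close_pairs (delta : R) (M : seq ((R * R) * (R * R))) : Prop :=
  forall xy, xy \in M -> plane_dist xy.1 xy.2 <= delta.

Definition near_diag (delta : R) (U : seq (R * R)) : Prop :=
  forall x, x \in U -> diag_dist x <= delta.

Definition delta_close (delta : R) (A B : seq (R * R)) : Prop :=
  exists M UA UB, [/\ partial_matching A B M UA UB, close_pairs delta M,
    near_diag delta UA & near_diag delta UB].

Definition delta_close_perfect (delta : R) (A B : seq (R * R)) : Prop :=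
  exists M, perfect_matching A B M /\ close_pairs delta M.

(* Barcodes are unique up to perm_eq, so it does not matter which ones are
   chosen. *)
Definition delta_matched (V W : pers_mod (ext_line R) k) (delta : R) : Prop :=
  exists BV BW, [/\ is_barcode V BV, is_barcode W BW,
    delta_close delta (Ord BV) (Ord BW),
    delta_close delta (Rel BV) (Rel BW) &
    delta_close_perfect delta (Ext BV) (Ext BW)].

(* +oo if no delta is admissible. *)
Definition bottleneck_dist (V W : pers_mod (ext_line R) k) : \bar R :=
  ereal_inf [set delta%:E | delta in
    [set delta : R | 0 < delta /\ delta_matched V W delta]].

End Bottleneck.

(* Main.v *)
From HB Require Import structures.
Require Import Defs.
From mathcomp Require Import all_boot all_order all_algebra.
From mathcomp Require Import lra.
From mathcomp Require Import classical_sets reals ereal.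
Import Order.TTheory GRing.Theory Num.Theory.
Local Open Scope ring_scope.

(** The proof interpolates linearly between the two weight functions and keeps
    track of the bars, as in the theory of vineyards.

    Suppose first that no pair of edges is inverted, i.e. that A e < A f implies
    A' e <= A' f.  Then the preorder of the edges by B = A + A' refines the
    preorders by A and by A', so every sublevel and superlevel set of A or of A'
    is one of B.  Hence both extended modules are pullbacks of the module of B,
    along monotone maps of the extended line that only take finitely many values
    (cell_near, ext_state_near, same_factor_iso).  A persistence module restricted
    to finitely many parameters splits into bars (sampled_basis), and each bar of
    B pulls back to one interval for A and one for A' (refined_barcodes).  Their
    endpoints are the A-weight and the A'-weight of the same edge, or one of the
    four bounds that do not depend on the weights: the two ends of the line and
    the two sides of infinity.  So matching bars by their origin in B moves every
    endpoint by at most the distance of A and A' (compatible_matched).  A bar that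
    is matched to nothing has an empty partner, which forces its own endpoints
    to lie in the same half of the line and close to each other; a bar from
    the ordinary to the reversed half of the line always has a partner, since it
    contains infinity.

    In general, let C be the point of the segment from A to A' where the first
    inverted pair becomes tied.  From A to C there is no inversion, from C to A'
    there are fewer than before, and the distances of A, C and of C, A' add up to
    that of A, A' (close_matched).  The two matchings at C are composed
    (matched_trans); they may use different barcodes of the module of C, which
    agree up to order because the ranks of its maps determine how many bars
    contain any two given points (barcode_of_uniq). *)

Set Implicit Arguments.
Unset Strict Implicit.
Unset Printing Implicit Defensive.

(** * Matchings of multisets *)

Section Matchings.
Variable T : eqType.
Implicit Types (c : T -> T -> Prop) (u : T -> Prop) (A B C : seq T).

(** The relation c is imposed on matched pairs, the predicate u on unmatched
    items: this covers the partial matchings of diagrams, the perfect ones (u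
    empty) and the matchings of barcodes on which all of them are read off. *)
Definition matched c u A B : Prop :=
  exists M UA UB, [/\ perm_eq A (unzip1 M ++ UA), perm_eq B (unzip2 M ++ UB),
    forall xy, xy \in M -> c xy.1 xy.2, forall x, x \in UA -> u x &
    forall x, x \in UB -> u x].

Lemma matched_sym c u A B :
  (forall x y, c x y -> c y x) -> matched c u A B -> matched c u B A.
Proof.
move=> cC [M [UA [UB [pA pB cM uA uB]]]].
exists [seq (xy.2, xy.1) | xy <- M], UB, UA; split=> //.
- by rewrite /unzip1 -map_comp.
- by rewrite /unzip2 -map_comp.
- by move=> _ /mapP[xy /cM/cC ? ->].
Qed.

Lemma matched_perm c u A A' B B' :
  perm_eq A A' -> perm_eq B B' -> matched c u A B -> matched c u A' B'.
Proof.
move=> pA pB [M [UA [UB [pAM pBM cM uA uB]]]]; exists M, UA, UB; split=> //.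
- by rewrite -(permPl pA).
- by rewrite -(permPl pB).
Qed.

Lemma matched_cons c u a b A B :
  c a b -> matched c u A B -> matched c u (a :: A) (b :: B).
Proof.
move=> cab [M [UA [UB [pAM pBM cM uA uB]]]]; exists ((a, b) :: M), UA, UB.
by split; rewrite //= ?perm_cons// => xy; rewrite inE => /predU1P[->|/cM].
Qed.

Lemma matched_dropl c u a A B :
  u a -> matched c u A B -> matched c u (a :: A) B.
Proof.
move=> ua [M [UA [UB [pAM pBM cM uA uB]]]]; exists M, (a :: UA), UB.
split=> //; last by move=> x; rewrite inE => /predU1P[->|/uA].
by rewrite perm_sym -cat1s perm_catCA cat1s perm_cons perm_sym.
Qed.

Lemma matched_dropr c u b A B :
  u b -> matched c u A B -> matched c u A (b :: B).
Proof.
move=> ub [M [UA [UB [pAM pBM cM uA uB]]]]; exists M, UA, (b :: UB).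
split=> //; last by move=> x; rewrite inE => /predU1P[->|/uB].
by rewrite perm_sym -cat1s perm_catCA cat1s perm_cons perm_sym.
Qed.

Lemma matched_consrP c u A b B : matched c u A (b :: B) ->
  (exists a A', [/\ perm_eq A (a :: A'), c a b & matched c u A' B]) \/
  (u b /\ matched c u A B).
Proof.
move=> [M [UA [UB [pAM pBM cM uA uB]]]].
have : b \in unzip2 M ++ UB by rewrite -(perm_mem pBM) mem_head.
rewrite mem_cat => /orP[/mapP[[a b'] abM /= bb']|bU].
  subst b'; left; exists a, (unzip1 (rem (a, b) M) ++ UA).
  have pM := perm_to_rem abM.
  split; first by rewrite (permPl pAM) -cat_cons perm_cat2r (perm_map _ pM).
    exact: (cM _ abM).
  exists (rem (a, b) M), UA, UB; split=> //; last first.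
    by move=> xy /mem_rem/cM.
  rewrite -(perm_cons b) (permPl pBM) -cat_cons perm_cat2r.
  exact: (perm_map snd pM).
right; split; first exact: uB.
exists M, UA, (rem b UB); split=> //; last by move=> x /mem_rem/uB.
rewrite -(perm_cons b) (permPl pBM) perm_sym -cat1s perm_catCA perm_cat2l.
by rewrite perm_sym perm_to_rem.
Qed.

(** Matchings compose by induction on the middle multiset, whose items are
    handed over one at a time: an item matched on one side only turns its partner
    into an unmatched item. *)
Lemma matched_trans c1 u1 c2 u2 c u A B C :
    (forall x y, c1 x y -> c1 y x) -> (forall x y, c2 x y -> c2 y x) ->
    (forall x y z, c1 x y -> c2 y z -> c x z) ->
    (forall x y, c1 x y -> u2 y -> u x) ->
    (forall x y, u1 y -> c2 y x -> u x) ->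
    (forall x, u1 x -> u x) -> (forall x, u2 x -> u x) ->
  matched c1 u1 A B -> matched c2 u2 B C -> matched c u A C.
Proof.
move=> c1C c2C cT uT1 uT2 u1u u2u.
elim: B A C => [|b B IH] A C mAB mBC.
  case: mAB => -[|? ?] [UA [UB [pA /perm_size sB _ uA _]]] //.
  case: mBC => -[|? ?] [UB' [UC [/perm_size sB' pC _ _ uC]]] //.
  exists [::], UA, UC; split=> // x; [by move/uA/u1u | by move/uC/u2u].
have {mBC} mCB := matched_sym c2C mBC.
have IH' A' C' : matched c1 u1 A' B -> matched c2 u2 C' B -> matched c u A' C'.
  by move=> mA /(matched_sym c2C); apply: IH.
case/matched_consrP: mAB => [[a [A' [pA cab mA]]]|[ub mA]];
case/matched_consrP: mCB => [[d [C' [pC cdb mC]]]|[vb mC]].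
- rewrite perm_sym in pA; rewrite perm_sym in pC.
  apply: (matched_perm pA pC); apply: matched_cons; last exact: IH'.
  exact: cT cab (c2C _ _ cdb).
- rewrite perm_sym in pA; apply: (matched_perm pA (perm_refl _)).
  by apply: matched_dropl; [exact: uT1 cab vb | exact: IH'].
- rewrite perm_sym in pC; apply: (matched_perm (perm_refl _) pC).
  by apply: matched_dropr; [exact: uT2 ub (c2C _ _ cdb) | exact: IH'].
- exact: IH'.
Qed.

End Matchings.

(** Bars of one type are selected by a partial function; matched bars must be
    selected together, otherwise a pair would be torn apart. *)
Lemma matched_pmap (T T' : eqType) (f : T -> option T') c u
    (c' : T' -> T' -> Prop) (u' : T' -> Prop) A B :
    (forall x y, c x y -> match f x, f y with
       Some a, Some b => c' a b | None, None => True | _, _ => False end) ->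
    (forall x, u x -> if f x is Some a then u' a else True) ->
  matched c u A B -> matched c' u' (pmap f A) (pmap f B).
Proof.
move=> cf uf [M [UA [UB [pA pB cM uA uB]]]].
pose g xy := if (f xy.1, f xy.2) is (Some a, Some b) then Some (a, b) else None.
have U (V : seq T) : (forall x, x \in V -> u x) ->
    forall y, y \in pmap f V -> u' y.
  move=> uV y; rewrite mem_pmap => /mapP[x /uV/uf + fx].
  by rewrite -fx.
exists (pmap g M), (pmap f UA), (pmap f UB); split; try exact: U.
- rewrite (permPl (perm_pmap f pA)) pmap_cat perm_cat2r.
  have -> // : pmap f (unzip1 M) = unzip1 (pmap g M).
  elim: M cM {pA pB} => //= -[x y] M IH cM.
  have {}IH : pmap f (unzip1 M) = unzip1 (pmap g M).
    by apply: IH => z zM; apply: cM; rewrite inE zM orbT.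
  have /cf /= := cM (x, y) (mem_head _ _).
  have -> : g (x, y) = if (f x, f y) is (Some a, Some b) then Some (a, b) else None.
    by [].
  by case: (f x) (f y) => [a|] [b|] //= _; rewrite IH.
- rewrite (permPl (perm_pmap f pB)) pmap_cat perm_cat2r.
  have -> // : pmap f (unzip2 M) = unzip2 (pmap g M).
  elim: M cM {pA pB} => //= -[x y] M IH cM.
  have {}IH : pmap f (unzip2 M) = unzip2 (pmap g M).
    by apply: IH => z zM; apply: cM; rewrite inE zM orbT.
  have /cf /= := cM (x, y) (mem_head _ _).
  have -> : g (x, y) = if (f x, f y) is (Some a, Some b) then Some (a, b) else None.
    by [].
  by case: (f x) (f y) => [a|] [b|] //= _; rewrite IH.
- move=> ab; rewrite mem_pmap => /mapP[[x y] /cM/cf /= + gxy].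
  by move: gxy; rewrite /g /=; case: (f x) (f y) => [a|] [b|] // [->].
Qed.

(** * Intervals of the extended line *)

Lemma maximal_mem d (T : porderType d) (s : seq T) :
  s != [::] -> exists2 m, m \in s & forall y, y \in s -> (m <= y)%O -> y = m.
Proof.
elim: s => // x s IH _.
have [-> |/IH[m ms mmax]] := eqVneq s [::].
  by exists x => [|y]; rewrite ?mem_head// inE => /eqP.
have [mx|mx] := boolP (m < x)%O; last first.
  exists m; first by rewrite inE ms orbT.
  move=> y; rewrite inE => /predU1P[-> mx'|/mmax//].
  by apply/eqP; move: mx; rewrite lt_neqAle mx' andbT negbK eq_sym.
exists x; first exact: mem_head.
move=> y; rewrite inE => /predU1P[//|ys xy].
by have := lt_le_trans mx xy; rewrite (mmax _ ys) ?ltxx// (ltW (lt_le_trans mx xy)).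
Qed.

(** Multiplicities are recovered from the numbers of items above each point by
    peeling off maximal items, above which there is nothing else. *)
Lemma perm_eq_upcount d (T : porderType d) (A B : seq T) :
    (forall x, x \in A ++ B -> count (>= x)%O A = count (>= x)%O B) ->
  perm_eq A B.
Proof.
move: {2}(size A) (leqnn (size A)) => n.
elim: n A B => [|n IH] A B.
  rewrite leqn0 size_eq0 => /eqP -> upC; case: B upC => // x B /(_ x).
  by rewrite mem_head /= lexx => /(_ isT).
case: (eqVneq (A ++ B) [::]) => [|AB0 sA upC]; first by case: A; case: B.
have [m mAB mmax] := maximal_mem AB0.
have mC S : {subset S <= A ++ B} -> count (>= m)%O S = count_mem m S.
  move=> sS; apply: eq_in_count => y /sS yAB /=.
  by apply/idP/eqP => [/(mmax _ yAB)|->].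
have mA_mB : count_mem m A = count_mem m B.
  have sAA : {subset A <= A ++ B} by move=> y; rewrite mem_cat => ->.
  have sBB : {subset B <= A ++ B} by move=> y; rewrite mem_cat orbC => ->.
  by rewrite -(mC _ sAA) -(mC _ sBB) upC.
have mA : m \in A.
  by move: mAB; rewrite mem_cat -!has_pred1 !has_count mA_mB orbb.
have mB : m \in B by rewrite -has_pred1 has_count -mA_mB -has_count has_pred1.
rewrite (permPl (perm_to_rem mA)) perm_sym (permPl (perm_to_rem mB)) perm_cons.
rewrite perm_sym; apply: IH => [|x xAB].
  by rewrite size_rem//; case: (A) sA.
have := upC x; rewrite (permP (perm_to_rem mA)) (permP (perm_to_rem mB)) /=.
move=> upx; apply/(@addnI (m >= x)%O)/upx.
by move: xAB; rewrite !mem_cat => /orP[/mem_rem ->//|/mem_rem ->]; rewrite orbT.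
Qed.

Section ExtLine.
Variable R : realType.
Notation EL := (ext_line R).
Implicit Types (x y z s t : EL) (l u : itv_bound EL) (I J : interval EL).

Lemma ext_below x : exists y, (y < x)%O.
Proof.
case: x => [a||b]; [exists (Fwd (a - 1))|exists (Fwd 0)|exists Infty] => //.
by rewrite lt_neqAle; apply/andP; split; [apply/eqP=> -[]|rewrite /Order.le /=]; lra.
Qed.

Lemma ext_above x : exists y, (x < y)%O.
Proof.
case: x => [a||b]; [exists Infty|exists (Bwd 0)|exists (Bwd (b - 1))] => //.
by rewrite lt_neqAle; apply/andP; split; [apply/eqP=> -[]|rewrite /Order.le /=]; lra.
Qed.

Lemma ext_leE x y : (x <= y)%O = ext_le x y. Proof. by []. Qed.

Lemma ext_dense x y : (x < y)%O -> exists z, (x < z < y)%O.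
Proof.
have FF (a a' : R) : (Fwd a < Fwd a' :> EL)%O = (a < a').
  by rewrite !ltNge ext_leE.
have BB (a a' : R) : (Bwd a < Bwd a' :> EL)%O = (a' < a).
  by rewrite !ltNge ext_leE.
case: x y => [a||b] [a'||b'] //.
- by rewrite FF => aa'; exists (Fwd ((a + a') / 2)); rewrite !FF; lra.
- by exists (Fwd (a + 1)); rewrite FF andbT; lra.
- by exists Infty.
- by exists (Bwd (b' + 1)); rewrite BB /=; lra.
- by rewrite BB => bb'; exists (Bwd ((b + b') / 2)); rewrite !BB; lra.
Qed.

(** The extended line is dense and has no ends, so there is room between any two
    bounds, even when both are excluded from the interval. *)
Lemma ext_itvP l u : reflect (exists t, t \in Interval l u) (l < u)%O.
Proof.
apply: (iffP idP) => [|[t]]; last first.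
  rewrite itv_boundlr => /andP[lt tu]; apply: le_lt_trans lt _.
  by apply: lt_le_trans tu; rewrite bnd_simp.
case: l u => [[] x|[]] [[] y|[]] //=; rewrite ?bnd_simp// => xy.
- by exists x; rewrite in_itv /= lexx.
- by exists x; rewrite in_itv /= lexx.
- by exists x; rewrite in_itv /= lexx.
- by have [z] := ext_dense xy; exists z; rewrite in_itv.
- by exists y; rewrite in_itv /= lexx andbT.
- by have [z] := ext_above x; exists z; rewrite in_itv /= andbT.
- by have [z] := ext_below y; exists z; rewrite in_itv.
- by exists y; rewrite in_itv /= lexx.
- by exists Infty.
Qed.

Lemma itv_convex I s x t : s \in I -> t \in I -> (s <= x <= t)%O -> x \in I.
Proof.
case: I => l u; rewrite !itv_boundlr => /andP[ls _] /andP[_ tu] /andP[sx xt].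
by rewrite (le_trans ls) ?bnd_simp// (le_trans _ tu) ?bnd_simp.
Qed.

Lemma itv_separate I J t : t \in I -> ~~ (I <= J)%O ->
  exists2 x, x \in I & x \notin J.
Proof.
have [tJ|] := boolP (t \in J); last by exists t.
case: I J tJ => l u [l' u'] tJ tI.
rewrite subitvE negb_and -!ltNge.
move: tI tJ; rewrite !itv_boundlr => /andP[lt tu] /andP[l't tu'].
case/orP => [/ext_itvP[x]|/ext_itvP[x]]; rewrite itv_boundlr => /andP[lx xu];
  exists x; rewrite !itv_boundlr.
- rewrite lx /=; apply: le_trans tu; move: (le_trans xu l't).
  by rewrite !bnd_simp; apply: ltW.
- by rewrite negb_and -ltNge; apply/orP; left; apply: lt_le_trans xu; rewrite bnd_simp.
- rewrite xu andbT; apply: le_trans lt _; move: (le_trans tu' lx).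
  by rewrite !bnd_simp; apply: ltW.
- by rewrite negb_and -!ltNge; apply/orP; right; apply: le_lt_trans lx _; rewrite bnd_simp.
Qed.

(** For each bar J of B that does not contain I, pick a point of I outside J; by
    convexity the least and the greatest of these points cannot both lie in J. *)
Lemma itv_two_points (B : seq (interval EL)) I t : t \in I ->
  exists s s', [/\ s \in I, s' \in I, (s <= s')%O & {in B, forall J,
    (s \in J) && (s' \in J) = (I <= J)%O}].
Proof.
move=> tI.
have sub (J : interval EL) s : (I <= J)%O -> s \in I -> s \in J.
  move=> IJ; exact: (subitvP IJ).
suff [s [s' [sI s'I ss' H]]] : exists s s', [/\ s \in I, s' \in I, (s <= s')%O &
    {in B, forall J, s \in J -> s' \in J -> (I <= J)%O}].
  exists s, s'; split=> // J JB; apply/andP/idP => [[]|IJ]; first exact: H.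
  by split; apply: sub IJ _.
elim: B => [|J B [s [s' [sI s'I ss' IH]]]]; first by exists t, t.
have [IJ|nIJ] := boolP (I <= J)%O.
  by exists s, s'; split=> // K; rewrite inE => /predU1P[->|/IH].
have [x xI xJ] := itv_separate tI nIJ.
exists (Order.min s x), (Order.max s' x); split.
- by case: (leP s x).
- by case: (leP s' x).
- by rewrite ge_min le_max ss'.
- move=> K; rewrite inE => KB mK MK.
  have cvx := itv_convex mK MK.
  case/predU1P: KB => [KJ|/IH]; last first.
    by apply; apply: cvx; rewrite ?ge_min ?le_max ?lexx ?ss' ?orbT.
  by rewrite KJ in cvx; rewrite cvx ?ge_min ?le_max ?lexx ?orbT in xJ.
Qed.

(** For the barcode of a module these counts are the ranks of its maps, so this is
    what makes barcodes unique. *)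
Lemma perm_eq_itvs (A B : seq (interval EL)) :
    (forall I, I \in A ++ B -> exists t, t \in I) ->
    (forall s t, (s <= t)%O -> count (fun I => (s \in I) && (t \in I)) A =
                               count (fun I => (s \in I) && (t \in I)) B) ->
  perm_eq A B.
Proof.
move=> ne AB; apply: perm_eq_upcount => I IAB; have [t tI] := ne I IAB.
have [s [s' [_ _ ss' H]]] := itv_two_points (A ++ B) tI.
have E (S : seq (interval EL)) : {subset S <= A ++ B} ->
    count (>= I)%O S = count (fun J => (s \in J) && (s' \in J)) S.
  by move=> sS; apply: eq_in_count => J /sS/H ->.
by rewrite !E ?AB// => J; rewrite mem_cat => ->; rewrite ?orbT.
Qed.

End ExtLine.

(** * Bases of persistence modules *)

(** The maps of interval modules are given by matrices with entries 1 whose sizes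
    are truth values; this is their effect on multiples of a generator. *)
Lemma const_mx_comb (k : fieldType) (V W : vectType k) (f : 'Hom(V, W))
    (bv bw : bool) (c : 'rV[k]_bv) v w :
  (bv -> f v = if bw then w else 0) ->
  f (\sum_i c 0 i *: v) = \sum_i (c *m (const_mx 1 : 'M_(bv, bw))) 0 i *: w.
Proof.
case: bv c => c fv; last first.
  rewrite big_ord0 linear0; apply/esym/big1 => i _.
  by rewrite mxE big_ord0 scale0r.
rewrite big_ord1 linearZ /= fv//; case: bw {fv}; last by rewrite scaler0 big_ord0.
by rewrite big_ord1 !mxE big_ord1 !mxE mulr1.
Qed.

Section PersBasis.
Variables (d : Order.disp_t) (P : orderType d) (k : fieldType).
Variable V : pers_mod P k.

(** A decomposition into interval modules, presented by generators of the bars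
    instead of an isomorphism: v j t generates the bar j at parameter t (and is
    arbitrary outside of the bar).  In this form decompositions are easy to
    extend by one bar and to pull back. *)
Definition pers_basis (J : eqType) (r : seq J) (I : J -> interval P)
    (v : J -> forall t, V t) : Prop :=
  (forall j s t (st : (s <= t)%O), j \in r -> s \in I j ->
     pm_map V st (v j s) = if t \in I j then v j t else 0) /\
  (forall t, basis_of fullv [seq v j t | j <- r & t \in I j]).

Section ToBarcode.
Variables (J : eqType) (I : J -> interval P) (v : J -> forall t, V t).

Definition interval_sum (r : seq J) : pers_mod P k :=
  foldr (fun I W => pm_sum (interval_mod k I) W) (pm_zero k P) (map I r).

(** The coefficient c is a row of length 0 or 1, so this is a multiple of the
    generator inside the bar and 0 outside. *)
Definition gen_comb j t (c : 'rV[k]_(t \in I j)) : V t :=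
  \sum_i c 0 i *: v j t.

Fixpoint bars_comb (r : seq J) t : interval_sum r t -> V t :=
  match r return interval_sum r t -> V t with
  | [::] => fun _ => 0
  | j :: r' => fun cw => gen_comb cw.1 + bars_comb cw.2
  end.

Lemma bars_comb_linear r t : linear (@bars_comb r t).
Proof.
elim: r => [|j r IH] a x y /=; first by rewrite scaler0 addr0.
rewrite IH scalerDr addrACA; congr (_ + _).
rewrite /gen_comb scaler_sumr -big_split; apply: eq_bigr => i _ /=.
by rewrite !mxE scalerDl scalerA.
Qed.

HB.instance Definition _ r t :=
  GRing.isLinear.Build k (interval_sum r t) (V t) _ (@bars_comb r t) (@bars_comb_linear r t).

Lemma gen_comb_in j t (c : 'rV[k]_(t \in I j)) :
  exists2 a : k, gen_comb c = a *: v j t & ((a = 0) -> c = 0) /\ ((t \notin I j) -> a = 0).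
Proof.
exists (\sum_i c 0 i); first by rewrite /gen_comb scaler_suml.
case: (t \in I j) c => c; split=> //.
  by rewrite big_ord1 => c0; apply/rowP=> i; rewrite mxE -c0 [i]ord1.
  by move=> _; apply/rowP=> -[].
by rewrite big_ord0.
Qed.

Lemma bars_comb_natural r s t (st : (s <= t)%O) x :
    (forall j, j \in r -> s \in I j ->
     pm_map V st (v j s) = if t \in I j then v j t else 0) ->
  pm_map V st (bars_comb x) = bars_comb (pm_map (interval_sum r) st x).
Proof.
elim: r x => [|j r IH] x vst /=; first by rewrite linear0.
have -> : pm_map (interval_sum (j :: r)) st x =
    (interval_map k (I j) s t x.1, pm_map (interval_sum r) st x.2) by exact: lfunE.
rewrite /= linearD; congr (_ + _); last first.
  by apply: IH => i ir; apply: vst; rewrite inE ir orbT.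
rewrite /gen_comb /interval_map lfunE /=.
by apply: const_mx_comb => sI; apply: vst; rewrite ?mem_head.
Qed.

Lemma bars_comb_inj r t : free [seq v j t | j <- r & t \in I j] ->
  forall x : interval_sum r t, bars_comb x = 0 -> x = 0.
Proof.
elim: r => [_ x _|j r IH] /=; first by apply/rowP=> -[].
move=> fr [c w] /=; have [a -> [ca a0]] := gen_comb_in c.
have wspan : bars_comb w \in <<[seq v j t | j <- r & t \in I j]>>%VS.
  elim: r w {IH fr} => [|i r IH] /=; first by move=> _; rewrite mem0v.
  move=> [c' w] /=; have [a' -> [_ a'0]] := gen_comb_in c'.
  case: ifP => [tI|/negbT/a'0 ->]; last by rewrite scale0r add0r.
  rewrite /= span_cons memv_add// ?memvZ ?memv_line//.
have [|[tI /IH inj_r]] : free (v j t :: [seq v j t | j <- r & t \in I j]) \/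
    t \notin I j /\ free [seq v j t | j <- r & t \in I j].
- by move: fr; case: ifP => _; [left | right].
- rewrite free_cons => /andP[vn /IH inj_r] e0.
  have a00 : a = 0.
    apply: contraNeq vn => an0; rewrite -[v j t](scalerK an0) memvZ//.
    by move/eqP: e0; rewrite addr_eq0 => /eqP ->; rewrite memvN.
  by move: e0; rewrite a00 scale0r add0r => /inj_r ->; rewrite ca.
- by rewrite a0// scale0r add0r => /inj_r ->; rewrite ca// a0.
Qed.

Lemma bars_comb_surj r t x : x \in <<[seq v j t | j <- r & t \in I j]>>%VS ->
  exists y : interval_sum r t, x = bars_comb y.
Proof.
elim: r x => [|j r IH] x /=.
  by rewrite span_nil memv0 => /eqP ->; exists 0.
move=> xspan.
have [a [w /IH[y ->] ->]] : exists a, exists2 w, w \in <<[seq v j t | j <- r & t \in I j]>>%VS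
    & x = \sum_(i < (t \in I j)) a *: v j t + w.
  move: xspan; case: (t \in I j) => /= xspan; last first.
    by exists 0, x; rewrite ?big_ord0 ?add0r.
  move: xspan; rewrite span_cons => /memv_addP[_ /vlineP[a ->] [w wr ->]].
  by exists a, w; rewrite ?big_ord1.
exists (const_mx a, y) => /=; congr (_ + _).
by rewrite /gen_comb; apply: eq_bigr => i _; rewrite mxE.
Qed.

End ToBarcode.

Lemma pers_basis_iso (J : eqType) (r : seq J) I v :
  @pers_basis J r I v -> pm_iso V (interval_sum I r).
Proof.
move=> [vmap vbas].
pose g t : 'Hom(interval_sum I r t, V t) := linfun (@bars_comb J I v r t).
have gi t : lker (g t) == 0%VS.
  apply/lker0P => x y; rewrite !lfunE /= => /eqP.
  rewrite -subr_eq0 -linearB => /eqP /bars_comb_inj xy; apply/eqP.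
  by rewrite -subr_eq0; apply/eqP/xy/(basis_free (vbas t)).
have gs t x : exists y, x = g t y.
  have [|y ->] := @bars_comb_surj J I v r t x; first by rewrite (span_basis (vbas t)) memvf.
  by exists y; rewrite lfunE.
have gK t : cancel (g t) (g t)^-1%VF by exact/lker0_lfunK.
have gK' t : cancel (g t)^-1%VF (g t) by move=> x; have [y ->] := gs t x; rewrite gK.
exists (fun t => (g t)^-1%VF); split=> [t|s t st]; first by exists (g t).
apply/lfunP=> x; rewrite !comp_lfunE; have [y ->] := gs s x.
rewrite gK; apply: (can_inj (gK t)); rewrite gK' !lfunE /= bars_comb_natural// => j jr.
exact: vmap.
Qed.

(** The map from s to t sends the generators that live at s to generators that
    live at t or to 0, so its rank counts the bars through both points. *)
Lemma pers_basis_rank (J : eqType) (r : seq J) I v s t (st : (s <= t)%O) :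
  @pers_basis J r I v ->
  count (fun I => (s \in I) && (t \in I)) (map I r) =
  \dim (limg (pm_map V st)).
Proof.
move=> [vmap vbas]; rewrite -(span_basis (vbas s)) limg_span.
set S := [seq v j t | j <- r & (s \in I j) && (t \in I j)].
have fS : free S.
  have : perm_eq [seq v j t | j <- r & t \in I j]
      (S ++ [seq v j t | j <- r & ~~ (s \in I j) && (t \in I j)]).
    rewrite -map_cat perm_map// !filter_predI.
    by rewrite perm_sym perm_filterC.
  by move=> /perm_free; rewrite (basis_free (vbas t)) => /esym/catl_free.
rewrite count_map -size_filter -(size_map (v ^~ t)) -/S.
rewrite -(eqP fS); congr (\dim _).
rewrite /S; elim: r vmap {vbas S fS} => //= j r IH vmap.
have {}IH := IH (fun i s t st ir => vmap i s t st (@mem_behead _ (j :: r) i ir)).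
case sI: (s \in I j) => //=; rewrite span_cons (vmap _ _ _ st (mem_head _ _) sI).
case: ifP => tI; first by rewrite /= span_cons IH.
by rewrite IH add0v.
Qed.

End PersBasis.

(** * Decomposition at finitely many parameters *)

Section Decomposition.
Variables (d : Order.disp_t) (P : orderType d) (k : fieldType).
Variable V : pers_mod P k.

(** The maps of V without the proof that their indices are ordered. *)
Definition tmap s t : 'Hom(V s, V t) :=
  if (s <= t)%O =P true is ReflectT st then pm_map V st else 0.

Lemma tmapE s t (st : (s <= t)%O) : tmap s t = pm_map V st.
Proof. by rewrite /tmap; case: eqP => // st'; rewrite (bool_irrelevance st' st). Qed.

Lemma tmap_id s x : tmap s s x = x.
Proof. by rewrite (tmapE (lexx s)) pm_map_id id_lfunE. Qed.

Lemma tmap_comp s t u x : (s <= t)%O -> (t <= u)%O ->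
  tmap t u (tmap s t x) = tmap s u x.
Proof.
move=> st tu; rewrite (tmapE st) (tmapE tu) (tmapE (le_trans st tu)).
by rewrite (pm_map_comp V st tu) comp_lfunE.
Qed.

Variables (Q : finType) (pt : Q -> P).

Definition submodule (K : forall c, {vspace V (pt c)}) :=
  forall c c' x, (pt c <= pt c')%O -> x \in K c -> tmap (pt c) (pt c') x \in K c'.

(** A class x born at the earliest nonzero parameter b spans a direct summand:
    if l is the last parameter at which x survives, choose a complement of the
    line of x there and take its preimages as complement between b and l.  The
    complement is a submodule because nothing lives before b. *)
Lemma split_bar (K : forall c, {vspace V (pt c)}) : submodule K ->
  (exists c, K c != 0%VS) ->
  exists b l x (K' : forall c, {vspace V (pt c)}),
  [/\ submodule K', (pt b <= pt l)%O,
    forall c, (pt b <= pt c)%O -> (tmap (pt b) (pt c) x == 0) = ~~ (pt c <= pt l)%O,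
    forall c, (pt b <= pt c <= pt l)%O ->
      tmap (pt b) (pt c) x \notin K' c /\
      (<[tmap (pt b) (pt c) x]> + K' c)%VS = K c &
    forall c, ~~ (pt b <= pt c <= pt l)%O -> K' c = K c].
Proof.
move=> Ksub [c0 Kc0].
case: (@arg_minP _ _ _ c0 (fun c => K c != 0%VS) pt Kc0) => b Kb bmin.
pose x := vpick (K b); have xK : x \in K b := memv_pick _.
have x0 : x != 0 by rewrite vpick0.
pose alive c := (pt b <= pt c)%O && (tmap (pt b) (pt c) x != 0).
have alb : alive b by rewrite /alive lexx tmap_id.
case: (@arg_maxP _ _ _ b alive pt alb) => l /andP[bl xl0] lmax.
pose H := (<[tmap (pt b) (pt l) x]>^C)%VS.
pose K' c := if (pt b <= pt c <= pt l)%O then (K c :&: tmap (pt c) (pt l) @^-1: H)%VS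
             else K c.
have dead c : (pt b <= pt c)%O -> (tmap (pt b) (pt c) x == 0) = ~~ (pt c <= pt l)%O.
  move=> bc; have [cl|lc] := leP (pt c) (pt l) => /=.
    apply: contraNF xl0 => /eqP xc0.
    by rewrite -(tmap_comp _ bc cl) xc0 linear0.
  by apply: contraTT lc => xc0; rewrite -leNgt; apply: lmax; rewrite /alive bc.
exists b, l, x, K'; split=> //.
- move=> c c' y cc'; rewrite /K'; case: ifP => bcl; case: ifP => bcl'.
  + rewrite !memv_cap => /andP[yK yH]; rewrite Ksub//=.
    move: yH; rewrite -!memv_preim tmap_comp//.
    by case/andP: bcl'.
  + by rewrite memv_cap => /andP[yK _]; apply: Ksub.
  + move=> yK; rewrite memv_cap Ksub//= -memv_preim.
    have cb : (pt c < pt b)%O.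
      rewrite ltNge; apply: contraFN bcl => -> /=.
      by case/andP: bcl' => _; apply: le_trans.
    have Kc : K c = 0%VS.
      by apply/eqP; apply: contraLR cb => /bmin; rewrite -leNgt.
    by move: yK; rewrite Kc memv0 => /eqP ->; rewrite !linear0 mem0v.
  + exact: Ksub.
- move=> c bcl; have /andP[bc cl] := bcl; rewrite /K' bcl; split.
    rewrite memv_cap -memv_preim tmap_comp// negb_and; apply/orP; right.
    apply: contra xl0 => xH; rewrite -memv0 -(capv_compl <[tmap (pt b) (pt l) x]>).
    by rewrite memv_cap memv_line.
  apply/eqP; rewrite eqEsubv subv_add -memvE Ksub//= capvSl /=.
  apply/subvP => y yK.
  have := memvf (tmap (pt c) (pt l) y).
  rewrite -(addv_complf <[tmap (pt b) (pt l) x]>).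
  move=> /memv_addP[_ /vlineP[a ->] [h hH yE]].
  rewrite -[y](subrKC (a *: tmap (pt b) (pt c) x)).
  apply: memv_add; first by rewrite memvZ// memv_line.
  rewrite memv_cap memvB ?memvZ ?Ksub//= -memv_preim linearB linearZ /=.
  by rewrite tmap_comp// yE addrAC subrr add0r.
- by move=> c /negbTE; rewrite /K' => ->.
Qed.

(** Split off one bar after the other; each lowers the sum of the dimensions.
    Bars are closed intervals [b, l] of sampled parameters. *)
Lemma sampled_basis (K : forall c, {vspace V (pt c)}) : submodule K ->
  exists (J : eqType) (r : seq J) (b l : J -> Q) (v : J -> forall c, V (pt c)),
  (forall j c c', j \in r -> (pt (b j) <= pt c <= pt (l j))%O ->
     (pt c <= pt c')%O ->
     tmap (pt c) (pt c') (v j c) = if (pt c' <= pt (l j))%O then v j c' else 0) /\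
  (forall c, basis_of (K c)
     [seq v j c | j <- r & (pt (b j) <= pt c <= pt (l j))%O]).
Proof.
have [n] := ubnP (\sum_c \dim (K c))%N; elim: n K => // n IH K.
rewrite ltnS => Kn Ksub.
have [/existsP K0|] := boolP [exists c, K c != 0%VS]; last first.
  rewrite negb_exists => /forallP K0.
  exists void, [::], (fun j : void => match j with end), (fun j : void => match j with end).
  exists (fun j : void => match j with end); split=> // c.
  by have := K0 c; rewrite negbK => /eqP ->; rewrite /= nil_basis.
have [b [l [x [K' [K'sub bl xdead xK' K'E]]]]] := split_bar Ksub K0.
have [|J [r [bs [ls [v [vmap vbas]]]]]] := IH K' _ K'sub.
  apply: leq_trans Kn; rewrite (bigD1 b)//= [X in (_ < X)%N](bigD1 b)//=.
  rewrite -addSn leq_add//.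
    have [xb eK] := xK' b (introT andP (conj (lexx _) bl)).
    rewrite ltnNge; apply: contra xb => dimK.
    have /eqP -> : K' b == K b by rewrite eqEdim dimK -eK addvSr.
    by rewrite memvE -eK addvSl.
  apply: leq_sum => c _; have [/xK'[_ <-]|/K'E ->//] := boolP (pt b <= pt c <= pt l)%O.
  by rewrite dimvS ?addvSr.
exists (option J), (None :: map Some r), (oapp bs b), (oapp ls l).
exists (fun j => if j is Some j' then v j' else fun c => tmap (pt b) (pt c) x).
split=> [[j|] c c' jr /= jc cc'|c].
- apply: vmap => //; move: jr; rewrite inE /= => /mapP[i ir [->]]; exact: ir.
- have /andP[bc _] := jc; rewrite tmap_comp//; case: ifP => // c'l.
  by apply/eqP; rewrite xdead ?c'l// (le_trans bc).
rewrite /= filter_map; have basc := vbas c.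
case: ifP => [bcl|/negbT/K'E <-]; last by rewrite -map_comp.
have [xn <-] := xK' c bcl; rewrite /= -map_comp /basis_of span_cons free_cons.
set s := map _ _; have -> : s = [seq v j c | j <- r & (pt (bs j) <= pt c <= pt (ls j))%O].
  by [].
by rewrite (span_basis basc) eqxx xn (basis_free basc).
Qed.

End Decomposition.

(** * Close bars and their diagrams *)

Section CloseBars.
Variable R : realType.
Notation EL := (ext_line R).
Implicit Types (eps : R) (u w : itv_bound EL) (I J : interval EL) (x y : R * R).

(** Bounds move with the weights inside each half of the extended line, but never
    from one of these six classes to another. *)
Definition bound_kind u : nat :=
  match u with
  | BInfty true => 0
  | BSide _ (Fwd _) => 1
  | BSide true Infty => 2
  | BSide false Infty => 3
  | BSide _ (Bwd _) => 4
  | BInfty false => 5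
  end.

(** Increasing on each class of bounds, which is why the reversed half of the line
    gets a sign. *)
Definition bound_val u : R :=
  match u with
  | BSide _ (Fwd a) => a
  | BSide _ (Bwd b) => - b
  | _ => 0
  end.

Definition bound_close eps u w : Prop :=
  bound_kind u = bound_kind w /\ `|bound_val u - bound_val w| <= eps.

Definition bar_close eps I J : Prop :=
  let: Interval l u := I in let: Interval l' u' := J in
  bound_close eps l l' /\ bound_close eps u u'.

(** A bar of length at most 2 eps with both ends in the same half of the line gives
    a point at distance at most eps from the diagonal. *)
Definition bar_short eps I : Prop :=
  let: Interval l u := I in bound_close (eps *+ 2) l u.

Lemma bound_close_sym eps u w : bound_close eps u w -> bound_close eps w u.
Proof. by case=> ? ?; split=> //; rewrite distrC. Qed.

Lemma bound_close_trans e1 e2 u w z :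
  bound_close e1 u w -> bound_close e2 w z -> bound_close (e1 + e2) u z.
Proof.
move=> [k1 d1] [k2 d2]; split; first exact: etrans k1 k2.
by apply: le_trans (ler_distD (bound_val w) _ _) _; apply: lerD.
Qed.

Lemma bound_close_le e1 e2 u w :
  e1 <= e2 -> bound_close e1 u w -> bound_close e2 u w.
Proof. by move=> e12 [? d1]; split=> //; apply: le_trans e12. Qed.

Lemma le_boundE u w : (u <= w)%O ->
  (bound_kind u <= bound_kind w)%N /\
  (bound_kind u = bound_kind w -> bound_val u <= bound_val w).
Proof.
have F (a a' : R) : (Fwd a <= Fwd a' :> EL)%O = (a <= a') by [].
have B (a a' : R) : (Bwd a <= Bwd a' :> EL)%O = (a' <= a) by [].
have F' (a a' : R) : (Fwd a < Fwd a' :> EL)%O = (a < a') by rewrite !ltNge F.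
have B' (a a' : R) : (Bwd a < Bwd a' :> EL)%O = (a' < a) by rewrite !ltNge B.
case: u w => [[] [a||a]|[]] [[] [a'||a']|[]] //; rewrite bnd_simp ?F ?B ?F' ?B' //= => aa';
  by split=> // _; rewrite ?lerN2// ltW.
Qed.

(** If u, w are moved by at most eps to u', w' and their order changes, then u'
    and w' are close.  This bounds the length of a bar whose partner is empty. *)
Lemma bound_close_reverse eps u w u' w' :
  bound_close eps u u' -> bound_close eps w w' ->
  (w <= u)%O -> (u' <= w')%O -> bound_close (eps *+ 2) u' w'.
Proof.
move=> [ku du] [kw dw] /le_boundE[k1 v1] /le_boundE[k2 v2].
have kE : bound_kind u' = bound_kind w'.
  by apply/eqP; rewrite eqn_leq k2 -ku -kw k1.
split=> //; move: (v1 (etrans kw (esym (etrans ku kE)))) (v2 kE) du dw.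
by rewrite !ler_norml mulr2n; lra.
Qed.

Lemma bar_matched_trans e1 e2 B1 B2 B3 :
  0 <= e1 -> 0 <= e2 ->
  matched (bar_close e1) (bar_short e1) B1 B2 ->
  matched (bar_close e2) (bar_short e2) B2 B3 ->
  matched (bar_close (e1 + e2)) (bar_short (e1 + e2)) B1 B3.
Proof.
have cC e (I J : interval EL) : bar_close e I J -> bar_close e J I.
  by case: I J => l u [l' u'] [? ?]; split; apply: bound_close_sym.
have cu e e' (I J : interval EL) : bar_close e I J -> bar_short e' J ->
    bar_short (e + e') I.
  case: I J => l u [l' u'] [ll' uu'] s.
  have := bound_close_trans (bound_close_trans ll' s) (bound_close_sym uu').
  by apply: bound_close_le; rewrite !mulr2n; lra.
have sle e e' (I : interval EL) : e <= e' -> bar_short e I -> bar_short e' I.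
  by case: I => l u ee'; apply: bound_close_le; rewrite !mulr2n; lra.
move=> e1_ge0 e2_ge0; apply: matched_trans; try exact: cC.
- move=> [l1 u1] [l2 u2] [l3 u3] [l12 u12] [l23 u23].
  by split; apply: bound_close_trans; eassumption.
- exact: cu.
- by move=> I J sJ /cC cJI; rewrite addrC; apply: cu cJI sJ.
- by move=> I; apply: sle; lra.
- by move=> I; apply: sle; lra.
Qed.

Lemma diag_dist_le x eps : `|x.1 - x.2| <= eps *+ 2 -> diag_dist x <= eps.
Proof.
move=> xe; apply: le_trans (_ : plane_dist x ((x.1 + x.2) / 2, (x.1 + x.2) / 2) <= _).
  apply: ge_inf; last by exists ((x.1 + x.2) / 2).
  exists 0 => _ [z _ <-]; rewrite /plane_dist le_max normr_ge0//.
rewrite /plane_dist ge_max !ler_norml /=; move: xe; rewrite ler_norml mulr2n.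
by move=> /andP[? ?]; apply/andP; split; lra.
Qed.

Lemma plane_dist_le x y eps :
  `|x.1 - y.1| <= eps -> `|x.2 - y.2| <= eps -> plane_dist x y <= eps.
Proof. by rewrite /plane_dist ge_max => -> ->. Qed.

Lemma matched_delta_close eps (A B : seq (R * R)) :
  matched (fun x y => plane_dist x y <= eps) (fun x => diag_dist x <= eps) A B ->
  delta_close eps A B.
Proof. by move=> [M [UA [UB [pA pB cM uA uB]]]]; exists M, UA, UB; split. Qed.

(** A short bar has both ends in the same class, so it never counts for the
    extended diagram: there the matching is perfect. *)
Lemma bar_matched_diagrams eps B B' :
  matched (bar_close eps) (bar_short eps) B B' ->
  [/\ delta_close eps (Ord B) (Ord B'), delta_close eps (Rel B) (Rel B') &
      delta_close_perfect eps (Ext B) (Ext B')].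
Proof.
have N (a b : R) : `|- a - - b| = `|a - b| by rewrite -opprD normrN.
move=> BB'; split.
- apply/matched_delta_close; move: BB'; apply: matched_pmap.
    move=> [l u] [l' u'] [].
    case: l l' => [[] [a||a]|[]] [[] [a'||a']|[]] [//= _ aa'];
    case: u u' => [[] [b||b]|[]] [[] [b'||b']|[]] [//= _ bb'] //;
    exact: plane_dist_le.
  move=> [l u]; case: l => [[] [a||a]|[]]; case: u => [[] [b||b]|[]] [//= _ ab] //;
  exact: diag_dist_le.
- apply/matched_delta_close; move: BB'; apply: matched_pmap.
    move=> [l u] [l' u'] [].
    case: l l' => [[] [a||a]|[]] [[] [a'||a']|[]] [//= _ aa'];
    case: u u' => [[] [b||b]|[]] [[] [b'||b']|[]] [//= _ bb'] //;
    by apply: plane_dist_le; rewrite -N.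
  move=> [l u]; case: l => [[] [a||a]|[]]; case: u => [[] [b||b]|[]] [//= _ ab] //;
  by apply: diag_dist_le; rewrite -N.
- have [M [UA [UB [pA pB cM uA uB]]]] : matched (fun x y => plane_dist x y <= eps)
      (fun=> False) (Ext B) (Ext B').
    move: BB'; apply: matched_pmap.
      move=> [l u] [l' u'] [].
      case: l l' => [[] [a||a]|[]] [[] [a'||a']|[]] [//= _ aa'];
      case: u u' => [[] [b||b]|[]] [[] [b'||b']|[]] [//= _ bb'] //;
      by apply: plane_dist_le => //; rewrite -N.
    by move=> [l u]; case: l => [[] [a||a]|[]]; case: u => [[] [b||b]|[]] [//= _ ab].
  exists M; split; last exact: cM.
  have nil (U : seq (R * R)) : (forall x, x \in U -> False) -> U = [::].
    by case: U => // x U /(_ x (mem_head _ _)).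
  by rewrite (nil _ uA) in pA; rewrite (nil _ uB) in pB.
Qed.

End CloseBars.

(** * Sampling a weight function *)

Section Cells.
Variables (R : realType) (T : finType).
Notation EL := (ext_line R).
Implicit Types (A B : T -> R) (t : EL) (a b : R).

(** The parameters at which the module of a weight function is sampled: on the
    left, a value below all weights and the weights of the edges; on the right,
    infinity, a reversed value above all weights and the reversed weights. *)
Definition cell : finType := (option T + option (option T))%type.

(** Any strict bound of all the weights would do. *)
Definition cell_bound B : R := 1 + \sum_e `|B e|.

Definition cell_pt B (c : cell) : EL :=
  match c with
  | inl None => Fwd (- cell_bound B)
  | inl (Some e) => Fwd (B e)
  | inr None => Infty
  | inr (Some None) => Bwd (cell_bound B)
  | inr (Some (Some e)) => Bwd (B e)
  end.

(** The bound from which on a cell counts for A: its edge enters the sublevel or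
    superlevel set there.  A cell without an edge counts from the beginning of its
    half of the line on. *)
Definition cell_cut A (c : cell) : itv_bound EL :=
  match c with
  | inl None => BInfty _ true
  | inl (Some e) => BSide true (Fwd (A e))
  | inr None => BSide true Infty
  | inr (Some None) => BSide false Infty
  | inr (Some (Some e)) => BSide true (Bwd (A e))
  end.

Lemma lt_cell_bound B e : `|B e| < cell_bound B.
Proof.
rewrite /cell_bound (bigD1 e)//=.
have : 0 <= \sum_(i | i != e) `|B i| by apply: sumr_ge0.
lra.
Qed.

Definition refines B A := forall e e', B e <= B e' -> A e <= A e'.

Variables (A B : T -> R).
Hypothesis BA : refines B A.

Lemma cell_cutS c c' : (cell_pt B c <= cell_pt B c')%O ->
  (cell_cut A c <= cell_cut A c')%O.
Proof.
have F a b : (Fwd a <= Fwd b :> EL)%O = (a <= b) by [].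
have W a b : (Bwd a <= Bwd b :> EL)%O = (b <= a) by [].
case: c c' => [[e|]|[[e|]|]] [[e'|]|[[e'|]|]] //=; rewrite ?F ?W ?bnd_simp //.
- exact: BA.
- by have := lt_cell_bound B e; rewrite ltr_norml => /andP[? ?] ?; exfalso; lra.
- exact: BA.
- by have := lt_cell_bound B e; rewrite ltr_norml => /andP[? ?] ?; exfalso; lra.
Qed.

(** The sampled parameter of B at which the same edges are present as at t for A:
    the last one that A has reached at t. *)
Definition cell_near t : cell :=
  [arg max_(c > (inl None : cell) | (cell_cut A c <= BSide true t)%O) cell_pt B c]%O.

(** A Galois connection between sampled parameters of B and parameters of A; the
    monotonicity of cell_near, the equality of the edge sets and the pullbacks of
    bars all follow from it. *)
Lemma cell_nearP c t :
  (cell_pt B c <= cell_pt B (cell_near t))%O = (cell_cut A c <= BSide true t)%O.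
Proof.
rewrite /cell_near; case: arg_maxP => // c' c't c'max.
apply/idP/idP => [/cell_cutS cc'|/c'max//]; exact: le_trans c't.
Qed.

Lemma cell_nearS s t : (s <= t)%O ->
  (cell_pt B (cell_near s) <= cell_pt B (cell_near t))%O.
Proof.
move=> st; rewrite cell_nearP; apply: le_trans (_ : (_ <= BSide true s)%O) _.
  by rewrite -cell_nearP.
by rewrite bnd_simp.
Qed.

End Cells.

(** * Modules with the same factorization *)

Section Factor.
Variables (d : Order.disp_t) (P : orderType d) (k : fieldType).
Variables (S : Type) (H : S -> vectType k) (Hmap : forall x y, 'Hom(H x, H y)).
Implicit Types (V W : pers_mod P k) (sigma tau : P -> S).

(** Up to isomorphism, V depends on its parameter through sigma only.  This is
    meant for modules whose spaces at parameters with equal sigma have different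
    types. *)
Definition factors_through V sigma : Prop :=
  exists (f : forall t, 'Hom(V t, H (sigma t))) (g : forall t, 'Hom(H (sigma t), V t)),
  [/\ forall t, cancel (f t) (g t), forall t, cancel (g t) (f t) &
    forall s t (st : (s <= t)%O) x,
      f t (pm_map V st x) = Hmap (sigma s) (sigma t) (f s x)].

Definition cast_hom x y (e : x = y) : 'Hom(H x, H y) :=
  eq_rect x (fun y => 'Hom(H x, H y)) \1%VF y e.

Lemma cast_homK x y (e : x = y) : cancel (cast_hom e) (cast_hom (esym e)).
Proof. by case: y / e => u; rewrite !id_lfunE. Qed.

Lemma cast_hom_natural x x' y y' (e : x = y) (e' : x' = y') u :
  cast_hom e' (Hmap x x' u) = Hmap y y' (cast_hom e u).
Proof. by case: y / e; case: y' / e'; rewrite !id_lfunE. Qed.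

(** The conclusion says that V is the pullback of W along h. *)
Lemma same_factor_iso V W sigma tau (h : P -> P) :
    factors_through V sigma -> factors_through W tau ->
    {homo h : s t / (s <= t)%O} -> (forall t, sigma t = tau (h t)) ->
  exists f : forall t, 'Hom(W (h t), V t),
    (forall t, bijective (f t)) /\
    forall s t (st : (s <= t)%O) x,
      pm_map V st (f s x) = f t (tmap W (h s) (h t) x).
Proof.
move=> [f [f' [fK f'K fnat]]] [g [g' [gK g'K gnat]]] hS e.
pose iso t := (f' t \o (cast_hom (esym (e t)) \o g (h t)))%VF.
have isoE t x : iso t x = f' t (cast_hom (esym (e t)) (g (h t) x)).
  by rewrite !comp_lfunE.
exists iso; split=> [t|s t st x].
  exists (fun x => g' (h t) (cast_hom (e t) (f t x))) => x.
    by rewrite isoE f'K -{1}[e t]esymK cast_homK gK.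
  by rewrite isoE g'K cast_homK fK.
rewrite (tmapE _ (hS _ _ st)) !isoE; apply: (can_inj (fK t)).
by rewrite fnat !f'K gnat (cast_hom_natural (esym (e s))).
Qed.

End Factor.

(** * The extended module as a function of edge sets *)

Section States.
Variables (k : fieldType) (R : realType) (X : finType) (E : {set X * X}).
Hypothesis E_loopless : forall x, (x, x) \notin E.
Variable p : nat.
Notation EL := (ext_line R).
Notation T := {e | e \in E}.
Implicit Types (A B : T -> R) (s t : EL).

Notation wd A := (WeightedDigraph E_loopless A).
Notation V A := (ext_path_module k (wd A) p).

(** All that the complex at t depends on: the edge set, and whether it is the
    absolute complex of this set or the one relative to it. *)
Definition ext_state A t : bool * {set X * X} :=
  match t with
  | Fwd a => (false, sublevel (wd A) a)
  | Infty => (false, E)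
  | Bwd b => (true, superlevel (wd A) b)
  end.

Definition state_complex (x : bool * {set X * X}) : chain_complex k :=
  let: (rel, F) := x in
  if rel then rel_path_complex k E F else path_complex k F.

Definition state_map x y : graded_map (state_complex x) (state_complex y) :=
  match x, y return graded_map (state_complex x) (state_complex y) with
  | (false, F), (false, F') => path_incl k F F'
  | (false, F), (true, F') => fun n => (path_proj k E F' n \o path_incl k F E n)%VF
  | (true, F), (true, F') => rel_path_incl k E F F'
  | (true, F), (false, F') => fun n => 0
  end.

Definition state_homology x := homology (state_complex x) p.

Definition state_homology_map x y : 'Hom(state_homology x, state_homology y) :=
  homology_map (state_map x y) p.

(** Identities, but only after a case analysis on t: the two types are not
    convertible for a variable t. *)
Definition to_state A t : 'Hom(V A t, state_homology (ext_state A t)) :=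
  match t return 'Hom(V A t, state_homology (ext_state A t)) with
  | Fwd a => \1%VF | Infty => \1%VF | Bwd b => \1%VF
  end.

Definition of_state A t : 'Hom(state_homology (ext_state A t), V A t) :=
  match t return 'Hom(state_homology (ext_state A t), V A t) with
  | Fwd a => \1%VF | Infty => \1%VF | Bwd b => \1%VF
  end.

Lemma to_stateK A t : cancel (to_state A t) (of_state A t).
Proof. by case: t => [a||b] x; apply: (etrans (id_lfunE _) (id_lfunE _)). Qed.

Lemma of_stateK A t : cancel (of_state A t) (to_state A t).
Proof. by case: t => [a||b] x; apply: (etrans (id_lfunE _) (id_lfunE _)). Qed.

Lemma to_state_natural A s t (st : (s <= t)%O) x :
  to_state A t (pm_map (V A) st x) = state_homology_map _ _ (to_state A s x).
Proof.
have idE (U W : vectType k) (f g : 'Hom(U, W)) u :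
    f = g -> (\1%VF : 'Hom(W, W)) (f u) = g ((\1%VF : 'Hom(U, U)) u).
  by move=> ->; rewrite !id_lfunE.
case: s t st x => [a||b] [a'||b'] st x; try by []; apply: idE; try reflexivity.
apply: eq_homology_map.
by rewrite /ext_complex_map /= /path_incl sup_incl_id comp_lfun1r.
Qed.

Lemma ext_path_factors A : factors_through state_homology_map (V A) (ext_state A).
Proof.
exists (to_state A), (of_state A); split; first exact: to_stateK.
  exact: of_stateK.
exact: to_state_natural.
Qed.

End States.

(** * Barcodes with generators *)

Section BarcodeOf.
Variables (R : realType) (k : fieldType).
Notation EL := (ext_line R).
Variable V : pers_mod EL k.

(** A barcode together with generators of its bars, from which the ranks can be
    computed. *)
Definition barcode_of (B : seq (interval EL)) : Prop :=
  exists (J : eqType) (r : seq J) (I : J -> interval EL) (v : J -> forall t, V t),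
  [/\ pers_basis r I v, B = map I r & forall i, i \in B -> exists t, t \in i].

Lemma barcode_ofP B : barcode_of B -> is_barcode V B.
Proof. by move=> [J [r [I [v [bas -> ne]]]]]; split=> //; apply: pers_basis_iso bas. Qed.

Lemma barcode_of_uniq B B' : barcode_of B -> barcode_of B' -> perm_eq B B'.
Proof.
move=> [J [r [I [v [bas -> ne]]]]] [J' [r' [I' [v' [bas' -> ne']]]]].
apply: perm_eq_itvs => [i|s t st].
  by rewrite mem_cat => /orP[/ne|/ne'].
by rewrite (pers_basis_rank st bas) (pers_basis_rank st bas').
Qed.

End BarcodeOf.

Lemma bijective_basis (k : fieldType) (U W : vectType k) (f : 'Hom(U, W)) s :
  bijective f -> basis_of fullv s -> basis_of fullv (map f s).
Proof.
move=> [g fK gK] bas.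
have <- : limg f = fullv.
  apply/eqP; rewrite eqEsubv subvf; apply/subvP => x _.
  by rewrite -[x]gK memv_img ?memvf.
apply: limg_basis_of => //; apply/eqP; rewrite -subv0.
apply/subvP => x; rewrite memv_cap memv_ker => /andP[_ /eqP fx].
by rewrite memv0 -(can_eq fK) fx linear0.
Qed.

Section Death.
Variables (d : Order.disp_t) (P : orderType d) (Q : finType) (pt : Q -> P).

(** The first sampled parameter after l, or nothing if l is last.  With it the
    bar from b to l becomes half-open; only then do both of its bounds move with
    the weights. *)
Definition death (l : Q) : option Q :=
  [pick c | (pt l < pt c)%O && [forall c', (pt l < pt c')%O ==> (pt c <= pt c')%O]].

Lemma deathP l c :
  (pt c <= pt l)%O = if death l is Some e then ~~ (pt e <= pt c)%O else true.
Proof.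
rewrite /death; case: pickP => [e /andP[le /forallP emin]|none].
  rewrite -ltNge; apply/idP/idP => [cl|ce]; first exact: le_lt_trans le.
  by rewrite leNgt; apply: contraTN ce => lc; rewrite -leNgt (implyP (emin c)).
rewrite leNgt; apply/negP => lc.
case: (@arg_minP _ _ _ c (fun c => (pt l < pt c)%O) pt lc) => e le emin.
have := none e; rewrite le /= => /negbT/negP; apply.
by apply/forallP => c'; apply/implyP => /emin.
Qed.

End Death.

(** * Matching along the segment of weight functions *)

Section Compatible.
Variables (k : fieldType) (R : realType) (X : finType) (E : {set X * X}).
Hypothesis E_loopless : forall x, (x, x) \notin E.
Variable p : nat.
Notation EL := (ext_line R).
Notation T := {e | e \in E}.
Implicit Types (A B : T -> R) (s t : EL).

Notation wd A := (WeightedDigraph E_loopless A).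
Notation V A := (ext_path_module k (wd A) p).

(** The edges present for A at t are those whose cells count at t, and by the
    Galois connection these are the cells up to cell_near. *)
Lemma ext_state_near A B t : refines B A ->
  ext_state E_loopless A t =
  ext_state E_loopless B (cell_pt B (cell_near A B t)).
Proof.
move=> BA.
have eqS (Q Q' : pred T) : Q =1 Q' ->
    [set val e | e : T & Q e] = [set val e | e : T & Q' e].
  move=> QQ'; apply/setP => x; apply/imsetP/imsetP => -[e];
    by rewrite inE => Qe ->; exists e; rewrite // inE ?QQ' // -QQ'.
have := cell_nearP BA _ t.
have : (cell_cut A (cell_near A B t) <= BSide true t)%O by rewrite -(cell_nearP BA).
case: t => [a||b] /=.
- case: (cell_near A B (Fwd a)) => [o|[[e|]|]] // _ near.
  have [x ox] : exists x, cell_pt B (inl o) = Fwd x.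
    by case: o {near} => [e|]; eexists.
  rewrite ox in near *; congr pair; apply: eqS => e.
  by have := near (inl (Some e)); rewrite /= bnd_simp => /esym.
- case: (cell_near A B Infty) => [o|[[e|]|]] // _ near.
  by have := near (inr None); case: o {near} => [e|].
- case: (cell_near A B (Bwd b)) => [o|[o|]] // _ near.
  + by have := near (inr None); case: o {near} => [e|].
  + have [x ox] : exists x, cell_pt B (inr (Some o)) = Bwd x.
      by case: o {near} => [e|]; eexists.
    rewrite ox in near *; congr pair; apply: eqS => e.
    by have := near (inr (Some (Some e))); rewrite /= bnd_simp => /esym.
  + by have := near (inr (Some None)).
Qed.

(** The pullback to A of the bar from b to l of B, made half-open by death. *)
Definition cell_bar A B (b l : cell T) : interval EL :=
  Interval (cell_cut A b)
    (if death (cell_pt B) l is Some e then cell_cut A e else BInfty _ false).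

Lemma mem_cell_bar A B b l t : refines B A ->
  (t \in cell_bar A B b l) =
  (cell_pt B b <= cell_pt B (cell_near A B t) <= cell_pt B l)%O.
Proof.
move=> BA; rewrite itv_boundlr -(cell_nearP BA); congr (_ && _).
rewrite deathP; case: death => [e|] //.
by rewrite (cell_nearP BA) -ltNge.
Qed.

Definition bar_proper (I : interval EL) := let: Interval l u := I in (l < u)%O.

Lemma bar_properP I : reflect (exists t, t \in I) (bar_proper I).
Proof. by case: I => l u; apply: ext_itvP. Qed.

(** The bars of B are chosen once, before A: this is what links the barcodes of
    two weight functions that B refines.  Pullbacks that are empty are dropped. *)
Lemma refined_barcodes B :
  exists (J : eqType) (r : seq J) (b l : J -> cell T),
  forall A, refines B A ->
    barcode_of (V A) [seq I <- [seq cell_bar A B (b j) (l j) | j <- r] | bar_proper I].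
Proof.
have [|J [r [b [l [v [vmap vbas]]]]]] :=
    @sampled_basis _ _ _ (V B) _ (cell_pt B) (fun c => fullv).
  by move=> *; rewrite memvf.
exists J, r, b, l => A BA.
have [f [fbij fnat]] := same_factor_iso (ext_path_factors k E_loopless p A)
  (ext_path_factors k E_loopless p B) (cell_nearS BA)
  (fun t => ext_state_near t BA).
exists J, [seq j <- r | bar_proper (cell_bar A B (b j) (l j))].
exists (fun j => cell_bar A B (b j) (l j)), (fun j t => f t (v j (cell_near A B t))).
split; last 2 first.
- by rewrite filter_map.
- by move=> I; rewrite mem_filter => /andP[/bar_properP].
split=> [j s t st|t].
  rewrite mem_filter !mem_cell_bar// => /andP[_ jr] /[dup] salive /andP[bs _].
  have nst := cell_nearS BA st.
  rewrite fnat vmap// (le_trans bs nst)/=.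
  by case: ifP => // _; rewrite linear0.
rewrite -filter_predI (eq_filter (a2 := fun j => (cell_pt B (b j) <=
   cell_pt B (cell_near A B t) <= cell_pt B (l j))%O)); last first.
  move=> j /=; rewrite -mem_cell_bar//; apply/andb_idr => tj.
  by apply/ext_itvP; exists t.
by rewrite map_comp; apply: bijective_basis.
Qed.

Lemma cell_cut_close A A' c eps : 0 <= eps ->
  (forall e, `|A e - A' e| <= eps) -> bound_close eps (cell_cut A c) (cell_cut A' c).
Proof.
move=> eps0 AA'.
have N (a b : R) : `|- a - - b| = `|a - b| by rewrite -opprD normrN.
by case: c => [[e|]|[[e|]|]]; split=> //=; rewrite ?N ?subrr ?normr0.
Qed.

Definition bars_matched eps A A' : Prop :=
  exists BA BA', [/\ barcode_of (V A) BA, barcode_of (V A') BA' &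
    matched (bar_close eps) (bar_short eps) BA BA'].

(** Bars with the same origin in A + A' are matched; if one of the two is empty,
    its bounds are in the wrong order and the other bar is short. *)
Lemma compatible_matched A A' eps : 0 <= eps ->
  (forall e, `|A e - A' e| <= eps) ->
  (forall e e', A e < A e' -> A' e <= A' e') -> bars_matched eps A A'.
Proof.
move=> eps0 AA' compat; pose B e := A e + A' e.
have BA : refines B A.
  move=> e e'; rewrite /B leNgt => /negP Be; rewrite leNgt; apply/negP => lt_A.
  by apply: Be; have := compat _ _ lt_A; lra.
have BA' : refines B A'.
  move=> e e'; rewrite /B leNgt => /negP Be; rewrite leNgt; apply/negP => lt_A'.
  have [lt_A|] := ltP (A e) (A e'); first by have := compat _ _ lt_A; lra.
  by move=> le_A; apply: Be; lra.
have [J [r [b [l bas]]]] := refined_barcodes B.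
eexists; eexists; split; [exact: bas BA|exact: bas BA'|].
elim: r {bas} => [|j r IH] /=; first by exists [::], [::], [::]; split.
set I := cell_bar A B _ _; set I' := cell_bar A' B _ _.
have II' : bar_close eps I I'.
  split; first exact: cell_cut_close.
  by case: death => [e|]; [exact: cell_cut_close | split; rewrite //= subrr normr0].
case: ifP => pI; case: ifP => pI' //.
- exact: matched_cons.
- apply: matched_dropl => //; move: pI pI' II'; rewrite /I /I' /cell_bar /=.
  move=> lu /negbT; rewrite -leNgt => ul [ll' uu'].
  by apply: (bound_close_reverse (bound_close_sym ll') (bound_close_sym uu') ul); apply: ltW.
- apply: matched_dropr => //; move: pI pI' II'; rewrite /I /I' /cell_bar /=.
  move=> /negbT; rewrite -leNgt => ul lu [ll' uu'].
  by apply: (bound_close_reverse ll' uu' ul); apply: ltW.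
Qed.

Lemma bars_matched_trans e1 e2 A1 A2 A3 : 0 <= e1 -> 0 <= e2 ->
  bars_matched e1 A1 A2 -> bars_matched e2 A2 A3 -> bars_matched (e1 + e2) A1 A3.
Proof.
move=> e1_ge0 e2_ge0 [B1 [B2 [bB1 bB2 m12]]] [B2' [B3 [bB2' bB3 m23]]].
exists B1, B3; split=> //.
have p2 := barcode_of_uniq bB2' bB2.
exact: bar_matched_trans e1_ge0 e2_ge0 m12 (matched_perm p2 (perm_refl _) m23).
Qed.

Definition inversions A A' : {set T * T} :=
  [set ef | (A ef.1 < A ef.2) && (A' ef.2 < A' ef.1)].

(** Induction on the number of inverted pairs, passing through the first point
    of the segment at which such a pair becomes tied. *)
Lemma close_matched A A' eps : 0 <= eps ->
  (forall e, `|A e - A' e| <= eps) -> bars_matched eps A A'.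
Proof.
move=> eps0; have [n] := ubnP #|inversions A A'|.
elim: n A A' eps eps0 => // n IH A A' eps eps0 invn AA'.
have [inv0|[ef0 ef0inv]] := set_0Vmem (inversions A A').
  apply: compatible_matched => // e e' Aee'; rewrite leNgt; apply/negP => A'ee'.
  have : (e, e') \in inversions A A' by rewrite inE Aee'.
  by rewrite inv0 inE.
(* The time at which the weights of an inverted pair agree. *)
pose tau (ef : T * T) : R :=
  (A ef.2 - A ef.1) / ((A ef.2 - A ef.1) + (A' ef.1 - A' ef.2)).
case: (@arg_minP _ _ _ ef0 (fun ef => ef \in inversions A A') tau ef0inv).
move=> [e1 f1] /[dup] inv1; rewrite inE /= => /andP[A1 A1'] tmin.
set t1 := tau (e1, f1) in tmin.
have t1E : t1 * ((A f1 - A e1) + (A' e1 - A' f1)) = A f1 - A e1.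
  by rewrite /t1 /tau /= divfK// gt_eqF//; lra.
have t1_ge0 : 0 <= t1.
  by rewrite divr_ge0 //=; lra.
have t1_le1 : t1 <= 1.
  by rewrite ler_pdivrMr /=; lra.
pose C e := A e + t1 * (A' e - A e).
have AC e : `|A e - C e| <= t1 * eps.
  have -> : A e - C e = t1 * (A e - A' e) by rewrite /C; lra.
  by rewrite normrM ger0_norm// ler_wpM2l.
have CA' e : `|C e - A' e| <= (1 - t1) * eps.
  have -> : C e - A' e = (1 - t1) * (A e - A' e) by rewrite /C; lra.
  by rewrite normrM ger0_norm ?subr_ge0// ler_wpM2l// subr_ge0.
have -> : eps = t1 * eps + (1 - t1) * eps by lra.
have t1e : 0 <= t1 * eps by apply: mulr_ge0.
have t1e' : 0 <= (1 - t1) * eps by apply: mulr_ge0; rewrite ?subr_ge0.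
apply: (bars_matched_trans (A2 := C)) => //.
  apply: compatible_matched => // e f Aef.
  have [A'ef|A'fe] := leP (A' e) (A' f).
    rewrite /C; nra.
  have := tmin (e, f); rewrite inE /= Aef A'fe => /(_ isT).
  rewrite /tau /= ler_pdivlMr /=; last by lra.
  rewrite /C; lra.
rewrite ltnS in invn; apply: IH => //; apply: leq_trans invn; apply: proper_card.
apply/properP; split; last first.
  exists (e1, f1) => //; rewrite inE /= negb_and -leNgt; apply/orP; left.
  rewrite /C; lra.
apply/fintype.subsetP => -[e f]; rewrite !inE /= => /andP[Cef A'fe].
(* A pair inverted between C and A' was inverted before: if A f <= A e, then the
   interpolation C would have C f <= C e. *)
rewrite A'fe andbT ltNge; apply/negP => Afe.
have m1 : 0 <= (1 - t1) * (A e - A f) by rewrite mulr_ge0 ?subr_ge0.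
have m2 : 0 <= t1 * (A' e - A' f) by rewrite mulr_ge0 // subr_ge0 ltW.
by move: Cef; rewrite /C; lra.
Qed.

End Compatible.

Unset Implicit Arguments.

Theorem theorem6p9 (k : fieldType) (R : realType) (X : finType)
    (E : {set X * X}) (E_loopless : forall x, (x, x) \notin E)
    (A0 Adelta : {e | e \in E} -> R) (delta : R) :
  weight_dist A0 Adelta = delta ->
  forall p : nat,
    (bottleneck_dist
       (ext_path_module k (WeightedDigraph E_loopless A0) p)
       (ext_path_module k (WeightedDigraph E_loopless Adelta) p)
     <= (weight_dist A0 Adelta)%:E)%E.
Proof.
move=> _ p; set eps := weight_dist A0 Adelta.
have eps0 : 0 <= eps by apply: bigmax_ge_id.
have close e : `|A0 e - Adelta e| <= eps by apply: le_bigmax.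
apply/lee_addgt0Pr => x x0; rewrite -EFinD; apply: ereal_inf_lbound.
(* The infimum runs over positive numbers, while eps may vanish. *)
exists (eps + x) => //; split; first by rewrite ltr_wpDl.
have [B [B' [bB bB' m]]] : bars_matched k E_loopless p (eps + x) A0 Adelta.
  apply: close_matched => [|e]; first by rewrite addr_ge0// ltW.
  by apply: le_trans (close e) _; rewrite lerDl ltW.
have [mO mR mE] := bar_matched_diagrams m.
by exists B, B'; split=> //; apply: barcode_ofP.
Qed.
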